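(* Let $0<\beta_2\le 1\le \beta_1<\infty$ and let $n\ge 1$ be an integer. Given non-negative initial data $(\omega_0,\rho_0)\in K^n((0,1))\times K^n((0,1))$, there exists $T=T(\omega_0,\rho_0)>0$ such that the system $$\partial_t\omega+u\,\partial_x\omega=\frac{\rho}{x},\qquad \partial_t\rho+u\,\partial_x\rho=0,$$ $$u(x,t)=x\int_{\min(\beta_2x,1)}^{\min(\beta_1x,1)}\frac{\omega(y,t)}{y}\,dy-x\int_{\min(\beta_1x,1)}^{1}\frac{\omega(y,t)}{y}\,dy,$$ $$\omega(x,0)=\omega_0(x),\qquad \rho(x,0)=\rho_0(x),$$ has a unique local-in-time solution $(\omega,\rho)\in C([0,T],K^n((0,1)))\times C([0,T],K^n((0,1)))$.
   Context: For an integer $n\ge 1$, $K^n((0,1))$ is the space of $C^n$ functions $f$ compactly supported in $(0,1)$, with size measured by $\|f\|_{K^n}:=\|f\|_{C^n}+(\min\{x: x\in\operatorname{supp}(f)\})^{-1}$ (for $f\equiv0$ the second term is understood to be $0$). The unknowns $\omega(x,t),\rho(x,t)$ are scalar functions of one space variable; the meaningful evolution takes place on $x\in(0,1)$. *)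

(* Defs.v *)
From Stdlib Require Export Reals.
From Coquelicot Require Export Coquelicot.

Open Scope R_scope.

(* A function compactly supported in (0,1) is represented by its extension by
   zero to all of R. *)

Definition supp (f : R -> R) : R -> Prop := adherence (fun x => f x <> 0).

Definition class_C (n : nat) (f : R -> R) : Prop :=
  forall k x, (k <= n)%nat ->
    ex_derive_n f k x /\ continuous (Derive_n f k) x.

Definition Kn (n : nat) (f : R -> R) : Prop :=
  class_C n f /\ compact (supp f) /\ included (supp f) (fun x => 0 < x < 1).

(* Only meaningful for bounded f: the projection [real] sends +oo to 0.  It is
   applied below to derivatives of elements of K^n and of their differences. *)
Definition sup_norm (f : R -> R) : R :=
  real (Lub_Rbar (fun y => exists x, y = Rabs (f x))).

Definition Cn_norm (n : nat) (f : R -> R) : R :=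
  sum_f_R0 (fun k => sup_norm (Derive_n f k)) n.

(* The infimum is a minimum when supp f is compact and nonempty.  For f = 0 it
   is +oo, and [Rbar_inv p_infty = 0] is the value required there. *)
Definition Kn_size (n : nat) (f : R -> R) : R :=
  Cn_norm n f + Rbar_inv (Glb_Rbar (supp f)).

(* C([0,T], K^n), where [f t] is the profile at time t.  The size on K^n is not
   a norm; continuity is continuity in C^n norm with K^n-size bounded on [0,T].
   The size itself is not required to be continuous in t: the minimum of the
   support of omega jumps at t = 0 as soon as rho_0 is supported further to the
   left than omega_0. *)
Definition C_Kn (n : nat) (T : R) (f : R -> R -> R) : Prop :=
  (forall t, 0 <= t <= T -> Kn n (f t)) /\
  (forall t0, 0 <= t0 <= T ->
     filterlim (fun t => Cn_norm n (fun x => f t x - f t0 x))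
       (within (fun t => 0 <= t <= T) (locally t0)) (locally 0)) /\
  (exists M, forall t, 0 <= t <= T -> Kn_size n (f t) <= M).

Definition velocity (beta1 beta2 : R) (w : R -> R) (x : R) : R :=
  x * RInt (fun y => w y / y) (Rmin (beta2 * x) 1) (Rmin (beta1 * x) 1)
  - x * RInt (fun y => w y / y) (Rmin (beta1 * x) 1) 1.

(* Classical solutions: the equations hold pointwise for x in (0,1) and
   0 < t < T.  The x-derivatives exist by membership in K^n, n >= 1. *)
Definition solves (beta1 beta2 T : R) (omega0 rho0 : R -> R)
    (omega rho : R -> R -> R) : Prop :=
  (forall t x, 0 < t < T -> 0 < x < 1 ->
     let u := velocity beta1 beta2 (omega t) x in
     ex_derive (fun s => omega s x) t /\
     Derive (fun s => omega s x) t + u * Derive (omega t) x = rho t x / x /\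
     ex_derive (fun s => rho s x) t /\
     Derive (fun s => rho s x) t + u * Derive (rho t) x = 0) /\
  (forall x, omega 0 x = omega0 x /\ rho 0 x = rho0 x).

Definition is_solution (n : nat) (beta1 beta2 T : R) (omega0 rho0 : R -> R)
    (omega rho : R -> R -> R) : Prop :=
  C_Kn n T omega /\ C_Kn n T rho /\
  solves beta1 beta2 T omega0 rho0 omega rho.

(* Main.v *)
Require Import Defs.
From Stdlib Require Import Lra Lia Psatz Classical ClassicalEpsilon FunctionalExtensionality.

(* Existence.  Let Y(t,s;x) be the position at time s of the particle which is at x
   at time t.  Along characteristics the system can be integrated, so omega, hence
   u, is an explicit functional of Y, and the whole problem is a fixed point
   equation for Y alone.  Writing Y = x exp(-Z) and u = x v, it reads
   Z(t,s;x) = int_s^t v(r, Y(t,r;x)) dr, a contraction in the sup norm for short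
   times: v involves only primitives of g = omega/x, so it is Lipschitz in log x,
   and g is Lipschitz in Z.  Regularity is then bootstrapped: if Z is C^k then so is
   g (k <= n), so v is C^(k+1), and the formula
   dY/dx = exp(- int_s^t (du/dx)(r, Y) dr) makes Y, hence Z, of class C^(k+1).
   The equations follow from the semigroup property of Y.

   Uniqueness.  If (omega,rho) and (omega',rho') are two solutions, apply a maximum
   principle to (omega-omega')^2 + (rho-rho')^2. *)

(** * Families of C^k functions *)

(** The cut-offs [min(beta * x, 1)] in the velocity threaten smoothness at [x = 1 / beta]. They
    become invisible once omega vanishes beyond 1. Hence the fixed point is sought among [Z] with
    [|Z| <= kap], where [b * exp kap < 1] and [[a, b]] contains the supports of the data: the
    supports then stay in [[a * exp (- kap), b * exp kap]], inside (0,1), and everything can be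
    studied on the whole line after extension by zero.

    The contraction is run in the sup norm only, because comparing [g0] along two flows costs one
    derivative of [g0]; in the C^n norm the data would be one derivative short. Regularity is
    therefore a separate step, and it cannot start by differentiating the fixed point equation,
    since that presupposes a differentiable [Y]: the formula for dY/dx is derived from difference
    quotients instead. As a by-product the length of the time interval depends on sup and Lipschitz
    bounds of the data, not on their higher derivatives.

    Uniqueness must cover arbitrary solutions of the class, for which no flow has been constructed,
    so it works on the equations directly. *)

Definition cts {U V : UniformSpace} (f : U -> V) : Prop :=
  forall x, continuous f x.

Lemma continuous_pair {U V W : UniformSpace} (f : U -> V) (g : U -> W) (x : U) :
  continuous f x -> continuous g x -> continuous (fun y => (f y, g y)) x.
Proof.
  intros hf hg. apply filterlim_locally. intros eps.
  generalize (proj1 (filterlim_locally _ _) hf eps)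
             (proj1 (filterlim_locally _ _) hg eps).
  intros h1 h2. generalize (filter_and _ _ h1 h2). apply filter_imp.
  intros y [a b]; split; assumption.
Qed.

Lemma cts_id {U : UniformSpace} : cts (fun x : U => x).
Proof. intros x; apply continuous_id. Qed.

Lemma cts_const {U V : UniformSpace} (c : V) : cts (fun _ : U => c).
Proof. intros x; apply continuous_const. Qed.

Lemma cts_fst {U V : UniformSpace} : cts (fun z : U * V => fst z).
Proof. intros [x y]; apply continuous_fst. Qed.

Lemma cts_snd {U V : UniformSpace} : cts (fun z : U * V => snd z).
Proof. intros [x y]; apply continuous_snd. Qed.

Lemma cts_pair {U V W : UniformSpace} (f : U -> V) (g : U -> W) :
  cts f -> cts g -> cts (fun x => (f x, g x)).
Proof. intros hf hg x; apply continuous_pair; auto. Qed.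

Lemma cts_comp {U V W : UniformSpace} (f : V -> W) (g : U -> V) :
  cts f -> cts g -> cts (fun x => f (g x)).
Proof. intros hf hg x; apply (continuous_comp g f); auto. Qed.

Lemma cts_plus {U : UniformSpace} (f g : U -> R) :
  cts f -> cts g -> cts (fun x => f x + g x).
Proof. intros hf hg x; apply (continuous_plus f g); auto. Qed.

Lemma cts_minus {U : UniformSpace} (f g : U -> R) :
  cts f -> cts g -> cts (fun x => f x - g x).
Proof. intros hf hg x; apply (continuous_minus f g); auto. Qed.

Lemma cts_opp {U : UniformSpace} (f : U -> R) : cts f -> cts (fun x => - f x).
Proof. intros hf x; apply (continuous_opp f); auto. Qed.

Lemma cts_mult {U : UniformSpace} (f g : U -> R) :
  cts f -> cts g -> cts (fun x => f x * g x).
Proof. intros hf hg x; apply (continuous_mult f g); auto. Qed.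

Lemma cts_exp {U : UniformSpace} (f : U -> R) :
  cts f -> cts (fun x => exp (f x)).
Proof.
  intros hf. apply (cts_comp exp f); auto. intros x.
  apply continuity_pt_filterlim, derivable_continuous_pt, derivable_pt_exp.
Qed.

Lemma cts_Rmax {U : UniformSpace} (f g : U -> R) :
  cts f -> cts g -> cts (fun x => Rmax (f x) (g x)).
Proof.
  intros hf hg.
  replace (fun x => Rmax (f x) (g x))
    with (fun x => (f x + g x + Rabs (f x - g x)) * / 2).
  - apply cts_mult; [|apply cts_const].
    apply cts_plus; [apply cts_plus; auto|].
    apply (cts_comp Rabs (fun x => f x - g x)); [|apply cts_minus; auto].
    intros x; apply continuous_Rabs.
  - apply functional_extensionality; intros x.
    unfold Rmax, Rabs; destruct (Rle_dec _ _), (Rcase_abs _); lra.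
Qed.

Lemma cts_Rmin {U : UniformSpace} (f g : U -> R) :
  cts f -> cts g -> cts (fun x => Rmin (f x) (g x)).
Proof.
  intros hf hg.
  replace (fun x => Rmin (f x) (g x)) with (fun x => - Rmax (- f x) (- g x)).
  - apply cts_opp, cts_Rmax; apply cts_opp; auto.
  - apply functional_extensionality; intros x.
    unfold Rmax, Rmin; destruct (Rle_dec _ _), (Rle_dec _ _); lra.
Qed.

(** * Compactness and integrals depending on a parameter *)

Lemma ex_RInt_cts (f : R -> R) (a b : R) : cts f -> ex_RInt f a b.
Proof. intros hf; apply (ex_RInt_continuous f); auto. Qed.

(** Tube lemma. Choice selects a radius at every [th], and [compactness_value_1d] turns these into
    one radius for the whole segment; its conclusion is doubly negated, whence the classical step.
    Each [th] is compared with a nearby centre [t], both at [q] and at [q0]. *)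
Lemma tube {Q : UniformSpace} (f : R -> Q -> R) (a b : R) (q0 : Q) :
  (forall th, a <= th <= b ->
     continuous (fun z : R * Q => f (fst z) (snd z)) (th, q0)) ->
  forall eps, 0 < eps ->
  locally q0 (fun q => forall th, a <= th <= b -> Rabs (f th q - f th q0) < eps).
Proof.
  intros hc eps heps.
  assert (hd : forall th, {d : posreal | a <= th <= b ->
     forall th' q, Rabs (th' - th) < d -> ball q0 d q ->
     Rabs (f th' q - f th q0) < eps / 2}).
  { intros th. apply constructive_indefinite_description.
    destruct (Rle_dec a th) as [h1|h1]; [destruct (Rle_dec th b) as [h2|h2]|].
    - assert (he : 0 < eps / 2) by lra.
      destruct (proj1 (filterlim_locally _ _) (hc th (conj h1 h2))
                  (mkposreal _ he)) as [d hd].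
      exists d. intros _ th' q h3 h4. apply (hd (th', q)).
      split; assumption.
    - exists (mkposreal 1 Rlt_0_1); intros; lra.
    - exists (mkposreal 1 Rlt_0_1); intros; lra. }
  destruct (compactness_value_1d a b (fun th => proj1_sig (hd th))) as [d hdd].
  exists d. intros q hq th hth.
  apply NNPP. intros hn. apply (hdd th hth). intros [t [ht [h1 h2]]].
  apply hn. clear hn.
  destruct (hd t) as [dt hdt]; simpl in *.
  assert (e1 := hdt ht th q h1 (ball_le _ _ _ h2 _ hq)).
  assert (e2 := hdt ht th q0 h1 (ball_center q0 dt)).
  replace (f th q - f th q0) with ((f th q - f t q0) - (f th q0 - f t q0)) by ring.
  eapply Rle_lt_trans; [apply Rabs_triang|]. rewrite Rabs_Ropp. lra.
Qed.

Lemma continuous_RInt_param {Q : UniformSpace} (f : R -> Q -> R) (a b : R) :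
  a <= b -> cts (fun z : R * Q => f (fst z) (snd z)) ->
  cts (fun q => RInt (fun th => f th q) a b).
Proof.
  intros hab hf q0. apply filterlim_locally. intros eps.
  assert (hc : forall q, cts (fun th => f th q)).
  { intros q. apply (cts_comp _ (fun th : R => (th, q)) hf).
    apply cts_pair; [apply cts_id|apply cts_const]. }
  (* The added 1 keeps the denominator positive when [a = b]. *)
  assert (he : 0 < eps / (b - a + 1)).
  { apply Rdiv_lt_0_compat; [apply cond_pos|lra]. }
  generalize (tube f a b q0 (fun th _ => hf (th, q0)) _ he).
  apply filter_imp. intros q hq. change (Rabs (RInt (fun th => f th q) a b
    - RInt (fun th => f th q0) a b) < eps).
  replace (RInt (fun th => f th q) a b - RInt (fun th => f th q0) a b)
    with (RInt (fun th => f th q - f th q0) a b).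
  2:{ apply (RInt_minus (fun th => f th q) (fun th => f th q0));
      apply ex_RInt_cts; auto. }
  eapply Rle_lt_trans.
  - apply abs_RInt_le_const with (M := eps / (b - a + 1)); auto.
    + apply ex_RInt_cts, cts_minus; auto.
    + intros t ht; left; auto.
  - assert (hp := cond_pos eps).
    apply Rmult_lt_reg_r with (b - a + 1); [lra|]. field_simplify; [|lra]. nra.
Qed.

(** Moves moving endpoints into the integrand, for any order of [a] and [b], so that only integrals
    over [0,1] have to be studied. *)
Lemma RInt_unit (f : R -> R) (a b : R) :
  cts f -> RInt f a b = (b - a) * RInt (fun th => f (a + th * (b - a))) 0 1.
Proof.
  intros hf.
  assert (h := RInt_comp_lin f (b - a) a 0 1).
  replace ((b - a) * 0 + a) with a in h by ring.
  replace ((b - a) * 1 + a) with b in h by ring.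
  rewrite <- h by (apply ex_RInt_cts; auto).
  rewrite RInt_scal.
  2:{ apply ex_RInt_cts. apply (cts_comp f (fun y => (b - a) * y + a)); auto.
      apply cts_plus; [apply cts_mult|]; auto using cts_const, cts_id. }
  unfold scal; simpl; unfold mult; simpl. f_equal. apply RInt_ext.
  intros x _. f_equal. ring.
Qed.

Lemma cts_RInt {Q : UniformSpace} (f : R -> Q -> R) (a b : Q -> R) :
  cts (fun z : R * Q => f (fst z) (snd z)) -> cts a -> cts b ->
  cts (fun q => RInt (fun r => f r q) (a q) (b q)).
Proof.
  intros hf ha hb.
  assert (hc : forall q, cts (fun th => f th q)).
  { intros q. apply (cts_comp _ (fun th : R => (th, q)) hf).
    apply cts_pair; [apply cts_id|apply cts_const]. }
  replace (fun q => RInt (fun r => f r q) (a q) (b q)) with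
   (fun q => (b q - a q) * RInt (fun th => f (a q + th * (b q - a q)) q) 0 1).
  2:{ apply functional_extensionality; intros q. symmetry.
      apply RInt_unit; auto. }
  apply cts_mult; [apply cts_minus; auto|].
  apply (continuous_RInt_param (fun th q => f (a q + th * (b q - a q)) q));
    [lra|].
  apply (cts_comp (fun z : R * Q => f (fst z) (snd z))
    (fun z : R * Q => (a (snd z) + fst z * (b (snd z) - a (snd z)), snd z)));
    auto.
  apply cts_pair; [|apply cts_snd].
  apply cts_plus; [apply (cts_comp a); auto using cts_snd|].
  apply cts_mult; [apply cts_fst|].
  apply cts_minus; [apply (cts_comp b)|apply (cts_comp a)]; auto using cts_snd.
Qed.

(** * Calculus of the classes [CC k] *)

Definition jcont {P : UniformSpace} (f : P -> R -> R) : Prop :=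
  cts (fun q : P * R => f (fst q) (snd q)).

(* Every [f p] is of class C^k, and its derivatives up to order [k] are continuous
   in [(p, x)] jointly. *)
Fixpoint CC {P : UniformSpace} (k : nat) (f : P -> R -> R) : Prop :=
  jcont f /\
  match k with
  | O => True
  | S k' => exists g, (forall p x, is_derive (f p) x (g p x)) /\ CC k' g
  end.

Section CC_calculus.

Context {P : UniformSpace}.
Implicit Types f g X : P -> R -> R.

Lemma CC_jcont k f : CC k f -> jcont f.
Proof. destruct k; intros h; apply h. Qed.

Lemma jcont_CC0 f : jcont f -> CC 0 f.
Proof. intros h; split; [exact h|exact I]. Qed.

Lemma CC_intro k f g :
  jcont f -> (forall p x, is_derive (f p) x (g p x)) -> CC k g -> CC (S k) f.
Proof. intros h1 h2 h3; split; auto. exists g; auto. Qed.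

Lemma CC_pred k f : CC (S k) f -> CC k f.
Proof.
  revert f; induction k as [|k IH]; intros f [h1 [g [h2 h3]]].
  - apply jcont_CC0; auto.
  - apply CC_intro with g; auto.
Qed.

Lemma CC_le j k f : (j <= k)%nat -> CC k f -> CC j f.
Proof. induction 1; auto using CC_pred. Qed.

Lemma jcont_at k f : CC k f -> forall p, cts (f p).
Proof.
  intros h p. apply (cts_comp _ (fun x : R => (p, x)) (CC_jcont _ _ h)).
  apply cts_pair; [apply cts_const|apply cts_id].
Qed.

Lemma CC_param k (phi : P -> R) : cts phi -> CC k (fun p _ => phi p).
Proof.
  intros h. revert phi h. induction k as [|k IH]; intros phi h.
  - apply jcont_CC0. apply (cts_comp phi); auto using cts_fst.
  - apply CC_intro with (fun _ _ => 0).
    + apply (cts_comp phi); auto using cts_fst.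
    + intros p x. apply @is_derive_const.
    + apply (IH (fun _ => 0)). apply cts_const.
Qed.

Lemma CC_const k (c : R) : CC k (fun (_ : P) _ => c).
Proof. apply CC_param, cts_const. Qed.

Lemma CC_id k : CC k (fun (_ : P) x => x).
Proof.
  assert (h : jcont (fun (_ : P) x => x)) by (apply cts_snd).
  destruct k as [|k]; [apply jcont_CC0; auto|].
  apply CC_intro with (fun _ _ => 1); auto using CC_const.
  intros p x; apply @is_derive_id.
Qed.

Lemma CC_plus k f g : CC k f -> CC k g -> CC k (fun p x => f p x + g p x).
Proof.
  revert f g; induction k as [|k IH]; intros f g hf hg.
  - apply jcont_CC0. apply cts_plus; [apply hf|apply hg].
  - destruct hf as [hf [f' [hf1 hf2]]], hg as [hg [g' [hg1 hg2]]].
    apply CC_intro with (fun p x => f' p x + g' p x); auto.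
    + apply cts_plus; auto.
    + intros p x. apply @is_derive_plus; auto.
Qed.

Lemma CC_mult k f g : CC k f -> CC k g -> CC k (fun p x => f p x * g p x).
Proof.
  revert f g; induction k as [|k IH]; intros f g hf hg.
  - apply jcont_CC0. apply cts_mult; [apply hf|apply hg].
  - assert (hf0 := CC_pred _ _ hf). assert (hg0 := CC_pred _ _ hg).
    destruct hf as [hf [f' [hf1 hf2]]], hg as [hg [g' [hg1 hg2]]].
    apply CC_intro with (fun p x => f' p x * g p x + f p x * g' p x).
    + apply cts_mult; auto.
    + intros p x. apply (is_derive_mult (f p) (g p)); auto. intros; apply Rmult_comm.
    + apply CC_plus; auto.
Qed.

Lemma CC_opp k f : CC k f -> CC k (fun p x => - f p x).
Proof.
  intros h. replace (fun p x => - f p x) with (fun p x => -1 * f p x).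
  - apply CC_mult; auto using CC_const.
  - do 2 (apply functional_extensionality; intro). ring.
Qed.

Lemma CC_minus k f g : CC k f -> CC k g -> CC k (fun p x => f p x - g p x).
Proof. intros hf hg; apply CC_plus; auto using CC_opp. Qed.

Lemma CC_comp k f X :
  CC k f -> CC k X -> CC k (fun p x => f p (X p x)).
Proof.
  assert (h0 : forall f X, jcont f -> jcont X -> jcont (fun p x => f p (X p x))).
  { intros f1 X1 h1 h2.
    apply (cts_comp _ (fun q : P * R => (fst q, X1 (fst q) (snd q))) h1).
    apply cts_pair; auto using cts_fst. }
  revert f X; induction k as [|k IH]; intros f X hf hX.
  - apply jcont_CC0. apply h0; [apply hf|apply hX].
  - assert (hX0 := CC_pred _ _ hX).
    destruct hf as [hf [f' [hf1 hf2]]], hX as [hX [X' [hX1 hX2]]].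
    apply CC_intro with (fun p x => X' p x * f' p (X p x)); auto.
    + intros p x. apply (is_derive_comp (f p) (X p)); auto.
    + apply CC_mult; auto.
Qed.

Lemma CC_exp k f : CC k f -> CC k (fun p x => exp (f p x)).
Proof.
  revert f; induction k as [|k IH]; intros f hf.
  - apply jcont_CC0. apply cts_exp, hf.
  - assert (hf0 := CC_pred _ _ hf).
    destruct hf as [hf [f' [hf1 hf2]]].
    apply CC_intro with (fun p x => f' p x * exp (f p x)).
    + apply cts_exp; auto.
    + intros p x. apply (is_derive_comp exp (f p)); auto. apply is_derive_exp.
    + apply CC_mult; auto.
Qed.

End CC_calculus.

Lemma CC_reparam {P Q : UniformSpace} k (f : P -> R -> R) (tau : Q -> P) :
  CC k f -> cts tau -> CC k (fun q => f (tau q)).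
Proof.
  assert (h0 : forall f : P -> R -> R,
    jcont f -> cts tau -> jcont (fun q => f (tau q))).
  { intros f1 h1 ht.
    apply (cts_comp _ (fun q : Q * R => (tau (fst q), snd q)) h1).
    apply cts_pair; [apply (cts_comp tau)|]; auto using cts_fst, cts_snd. }
  revert f; induction k as [|k IH]; intros f hf ht.
  - apply jcont_CC0, h0; auto. apply hf.
  - destruct hf as [hf [f' [hf1 hf2]]].
    apply CC_intro with (fun q => f' (tau q)); auto.
Qed.

Lemma is_derive_RInt_unit (f g : R -> R -> R) (x0 : R) :
  (forall th x, is_derive (f th) x (g th x)) -> jcont f -> jcont g ->
  is_derive (fun x => RInt (fun th => f th x) 0 1) x0
            (RInt (fun th => g th x0) 0 1).
Proof.
  intros hd hf hg.
  assert (hD : forall th x, Derive (fun z => f th z) x = g th x).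
  { intros; apply is_derive_unique, hd. }
  replace (RInt (fun th => g th x0) 0 1)
    with (RInt (fun th => Derive (fun z => f th z) x0) 0 1).
  2:{ apply RInt_ext; intros; apply hD. }
  apply (is_derive_RInt_param (fun x th => f th x)).
  - apply filter_forall. intros x t _. exists (g t x); apply hd.
  - intros t _. apply continuity_2d_pt_filterlim.
    replace (fun z : R * R => Derive (fun z0 => f (snd z) z0) (fst z))
      with (fun z : R * R => g (snd z) (fst z)).
    2:{ apply functional_extensionality; intros z; symmetry; apply hD. }
    rewrite hD.
    apply (cts_comp (fun q : R * R => g (fst q) (snd q))
             (fun z : R * R => (snd z, fst z)) hg (cts_pair _ _ cts_snd cts_fst)
             (x0, t)).
  - apply filter_forall. intros x. apply ex_RInt_cts.
    apply (cts_comp _ (fun th : R => (th, x)) hf).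
    apply cts_pair; [apply cts_id|apply cts_const].
Qed.

(** The integration variable is made part of the parameter, so [CC k f] already contains the joint
    continuity that differentiation under the integral requires, and the induction hypothesis
    applies to the derivative as it stands. *)
Lemma CC_RInt_unit {P : UniformSpace} k (f : R * P -> R -> R) :
  CC k f -> CC k (fun p x => RInt (fun th => f (th, p) x) 0 1).
Proof.
  assert (h0 : forall f : R * P -> R -> R, jcont f ->
     jcont (fun p x => RInt (fun th => f (th, p) x) 0 1)).
  { intros f1 h1.
    apply (continuous_RInt_param
             (fun th (q : P * R) => f1 (th, fst q) (snd q))); [lra|].
    apply (cts_comp _
      (fun z : R * (P * R) => ((fst z, fst (snd z)), snd (snd z))) h1).
    repeat apply cts_pair; auto using cts_fst;
    [apply (cts_comp fst)|apply (cts_comp snd)]; auto using cts_fst, cts_snd. }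
  revert f; induction k as [|k IH]; intros f hf.
  - apply jcont_CC0, h0, hf.
  - destruct hf as [hf [f' [hf1 hf2]]].
    apply CC_intro with (fun p x => RInt (fun th => f' (th, p) x) 0 1); auto.
    assert (hs : forall (F : R * P -> R -> R) p, jcont F ->
                   jcont (fun th : R => F (th, p))).
    { intros F p hF. apply (cts_comp _ (fun z : R * R => ((fst z, p), snd z)) hF).
      repeat apply cts_pair; auto using cts_fst, cts_snd, cts_const. }
    intros p x. apply (is_derive_RInt_unit (fun th => f (th, p))
                         (fun th => f' (th, p))); auto.
    apply hs. eapply CC_jcont; eauto.
Qed.

(** The endpoints depend on the parameter but not on [x]: after rescaling to [0,1] they enter only
    as a continuous reparametrisation and produce no boundary terms in x-derivatives. *)
Lemma CC_RInt {P : UniformSpace} k (f : R * P -> R -> R) (a b : P -> R) :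
  CC k f -> cts a -> cts b ->
  CC k (fun p x => RInt (fun r => f (r, p) x) (a p) (b p)).
Proof.
  intros hf ha hb.
  replace (fun p x => RInt (fun r => f (r, p) x) (a p) (b p)) with
   (fun p x => (b p - a p) *
      RInt (fun th => f (a p + th * (b p - a p), p) x) 0 1).
  2:{ do 2 (apply functional_extensionality; intro). symmetry.
      apply (RInt_unit (fun r => f (r, x) x0)).
      apply (cts_comp _ (fun r : R => ((r, x), x0)) (CC_jcont _ _ hf)).
      repeat apply cts_pair; auto using cts_id, cts_const. }
  apply CC_mult; [apply CC_param, cts_minus; auto|].
  apply (CC_RInt_unit k
    (fun z : R * P => f (a (snd z) + fst z * (b (snd z) - a (snd z)), snd z))).
  apply (CC_reparam k f
    (fun z : R * P => (a (snd z) + fst z * (b (snd z) - a (snd z)), snd z)));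
  auto.
  apply cts_pair; [|apply cts_snd].
  apply cts_plus; [apply (cts_comp a); auto using cts_snd|].
  apply cts_mult; [apply cts_fst|].
  apply cts_minus; [apply (cts_comp b)|apply (cts_comp a)]; auto using cts_snd.
Qed.

Lemma is_derive_RInt_lower (g : R -> R) (b x : R) :
  cts g -> is_derive (fun z => RInt g z b) x (- g x).
Proof.
  intros hg. apply (is_derive_RInt' g (fun z => RInt g z b) x b); auto.
  apply filter_forall. intros y. apply (RInt_correct g). apply ex_RInt_cts; auto.
Qed.

(** The gain of one derivative from omega to the velocity, which drives the bootstrap. *)
Lemma CC_primitive {P : UniformSpace} k (g : P -> R -> R) :
  CC k g -> CC (S k) (fun p z => RInt (g p) z 1).
Proof.
  intros hg. apply CC_intro with (fun p x => - g p x).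
  - apply (cts_RInt (fun r (q : P * R) => g (fst q) r)
             (fun q : P * R => snd q) (fun _ => 1)); auto using cts_snd, cts_const.
    apply (cts_comp _ (fun z : R * (P * R) => (fst (snd z), fst z))
             (CC_jcont _ _ hg)).
    apply cts_pair; auto using cts_fst. apply (cts_comp fst); auto using cts_fst, cts_snd.
  - intros p x. apply is_derive_RInt_lower. eapply jcont_at; eauto.
  - apply CC_opp; auto.
Qed.

(** * The backward flow as a fixed point *)

(** The uniqueness device for equations with contraction factor 1/2: it identifies the limit as a
    fixed point in [banach], and replaces Gronwall's inequality in [flow_semigroup]. *)
Lemma half_contraction_zero (B d : R) :
  (forall k : nat, Rabs d <= B * (/ 2) ^ k) -> d = 0.
Proof.
  intros h. assert (hl : is_lim_seq (fun k => B * (/ 2) ^ k) (B * 0)).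
  { apply (is_lim_seq_scal_l _ B 0), is_lim_seq_geom.
    rewrite Rabs_pos_eq; lra. }
  assert (h1 := is_lim_seq_le (fun _ => Rabs d) _ (Rabs d) (B * 0) h
                  (is_lim_seq_const _) hl).
  simpl in h1. apply Rabs_eq_0. assert (h2 := Rabs_pos d). lra.
Qed.

(** Contraction principle in the sup norm, with the complete space described by the predicate
    [Good]; the last hypothesis is its closedness under geometrically fast uniform convergence.
    Iterates converge pointwise, and the Cauchy bound, being uniform, passes to the limit. *)
Lemma banach {A : Type} (Good : (A -> R) -> Prop) (Psi : (A -> R) -> A -> R)
    (f0 : A -> R) (B : R) :
  Good f0 -> (forall f, Good f -> Good (Psi f)) ->
  (forall f p, Good f -> Rabs (f p) <= B) ->
  (forall f g d, Good f -> Good g -> (forall p, Rabs (f p - g p) <= d) ->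
     forall p, Rabs (Psi f p - Psi g p) <= d * / 2) ->
  (forall (u : nat -> A -> R) f, (forall k, Good (u k)) ->
     (forall k p, Rabs (f p - u k p) <= 4 * B * (/ 2) ^ k) -> Good f) ->
  exists f, Good f /\ forall p, Psi f p = f p.
Proof.
  intros h0 hPsi hB hc hcl.
  set (u := fix u k := match k with O => f0 | S k => Psi (u k) end).
  assert (hu : forall k, Good (u k)) by (induction k; simpl; auto).
  assert (hstep : forall k p, Rabs (u (S k) p - u k p) <= 2 * B * (/ 2) ^ k).
  { induction k as [|k IH]; intros p.
    - assert (e1 := hB _ p (hu 1%nat)). assert (e2 := hB _ p (hu 0%nat)).
      unfold Rminus. eapply Rle_trans; [apply Rabs_triang|].
      rewrite Rabs_Ropp. simpl pow. lra.
    - change (u (S (S k))) with (Psi (u (S k))).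
      change (u (S k) p) with (Psi (u k) p).
      eapply Rle_trans; [apply hc; auto; apply IH|]. simpl pow. lra. }
  (* The geometric tail is kept exact, [2 * B] times the sum of [(/ 2) ^ i] for [k <= i < j + k], so
     that the induction on [j] closes. *)
  assert (hfar : forall k j p, Rabs (u (j + k)%nat p - u k p)
                   <= 4 * B * (/ 2) ^ k - 4 * B * (/ 2) ^ (j + k)).
  { intros k j p. induction j as [|j IH].
    - simpl. unfold Rminus. rewrite !Rplus_opp_r, Rabs_R0. lra.
    - assert (e := hstep (j + k)%nat p).
      replace (u (S j + k)%nat p - u k p) with
        ((u (S (j + k)) p - u (j + k)%nat p) + (u (j + k)%nat p - u k p))
        by (simpl; ring).
      eapply Rle_trans; [apply Rabs_triang|].
      change ((/ 2) ^ (S j + k)) with (/ 2 * (/ 2) ^ (j + k)). lra. }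
  (* A point of [A] is needed here: on an empty type nothing fixes the sign of [B]. *)
  assert (hB0 : forall p : A, 0 <= B).
  { intros p. eapply Rle_trans; [apply Rabs_pos|apply (hB _ p h0)]. }
  assert (hfar' : forall k j p, Rabs (u (j + k)%nat p - u k p)
                   <= 4 * B * (/ 2) ^ k).
  { intros k j p. eapply Rle_trans; [apply hfar|].
    assert (e := pow_le (/ 2) (j + k)). assert (e2 := hB0 p). nra. }
  assert (hlim0 : is_lim_seq (fun k => 4 * B * (/ 2) ^ k) 0).
  { replace (Finite 0) with (Rbar_mult (4 * B) 0) by (simpl; f_equal; ring).
    apply is_lim_seq_scal_l, is_lim_seq_geom. rewrite Rabs_pos_eq; lra. }
  assert (hex : forall p, ex_finite_lim_seq (fun k => u k p)).
  { intros p. apply ex_lim_seq_cauchy_corr. intros eps.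
    destruct (proj2 (is_lim_seq_spec _ _) hlim0 (pos_div_2 eps)) as [N hN].
    exists N. intros n m hn hm. specialize (hN N (le_n N)).
    rewrite Rminus_0_r in hN. apply Rabs_lt_between in hN. simpl in hN.
    assert (e1 := hfar' N (n - N)%nat p). assert (e2 := hfar' N (m - N)%nat p).
    replace (n - N + N)%nat with n in e1 by lia.
    replace (m - N + N)%nat with m in e2 by lia.
    replace (u n p - u m p) with ((u n p - u N p) - (u m p - u N p)) by ring.
    eapply Rle_lt_trans; [apply Rabs_triang|]. rewrite Rabs_Ropp. lra. }
  set (f := fun p => real (Lim_seq (fun k => u k p))).
  assert (hf : forall k p, Rabs (f p - u k p) <= 4 * B * (/ 2) ^ k).
  { intros k p.
    assert (hl := Lim_seq_correct' _ (hex p)).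
    apply (is_lim_seq_incr_n _ k) in hl.
    assert (hl2 : is_lim_seq (fun j => Rabs (u (j + k)%nat p - u k p))
                    (Rabs (f p - u k p))).
    { apply (is_lim_seq_abs _ (Finite (f p - u k p))).
      apply is_lim_seq_minus'; [exact hl|apply is_lim_seq_const]. }
    exact (is_lim_seq_le _ _ _ (Finite (4 * B * (/ 2) ^ k))
            (fun j => hfar' k j p) hl2 (is_lim_seq_const _)). }
  assert (hG := hcl u f hu hf).
  exists f. split; auto. intros p.
  apply Rminus_diag_uniq, half_contraction_zero with (8 * B). intros k.
  assert (e1 := hc _ _ _ hG (hu k) (hf k) p).
  assert (e2 := hf (S k) p).
  change (u (S k)) with (Psi (u k)) in e2. simpl pow in e2.
  replace (Psi f p - f p) with ((Psi f p - Psi (u k) p) - (f p - Psi (u k) p)) by ring.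
  eapply Rle_trans; [apply Rabs_triang|]. rewrite Rabs_Ropp.
  assert (e3 := pow_le (/ 2) k). assert (e4 := hB0 p). nra.
Qed.

Lemma cts_uniform_limit {U : UniformSpace} (u : nat -> U -> R) (f : U -> R) (B : R) :
  (forall k, cts (u k)) ->
  (forall k p, Rabs (f p - u k p) <= B * (/ 2) ^ k) -> cts f.
Proof.
  intros hu hf p. apply filterlim_locally. intros eps.
  assert (hl : is_lim_seq (fun k => B * (/ 2) ^ k) 0).
  { replace (Finite 0) with (Rbar_mult B 0) by (simpl; f_equal; ring).
    apply is_lim_seq_scal_l, is_lim_seq_geom. rewrite Rabs_pos_eq; lra. }
  assert (he : 0 < eps / 3) by (assert (h := cond_pos eps); lra).
  destruct (proj2 (is_lim_seq_spec _ _) hl (mkposreal _ he)) as [N hN].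
  specialize (hN N (le_n N)).
  rewrite Rminus_0_r in hN. apply Rabs_lt_between in hN. simpl in hN.
  generalize (proj1 (filterlim_locally _ _) (hu N p) (mkposreal _ he)).
  apply filter_imp. intros q hq.
  change (Rabs (u N q - u N p) < eps / 3) in hq.
  change (Rabs (f q - f p) < eps).
  assert (e1 := hf N q). assert (e2 := hf N p).
  replace (f q - f p) with ((f q - u N q) + (u N q - u N p) - (f p - u N p)) by ring.
  eapply Rle_lt_trans; [apply Rabs_triang|]. rewrite Rabs_Ropp.
  assert (e3 := Rabs_triang (f q - u N q) (u N q - u N p)). lra.
Qed.

Lemma exp_le_3_of_abs_le_1 (x : R) : Rabs x <= 1 -> 0 < exp x <= 3.
Proof.
  intros h. split; [apply exp_pos|]. apply Rabs_le_between in h.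
  eapply Rle_trans; [|apply exp_le_3].
  destruct (Rle_lt_or_eq_dec x 1) as [h1|h1]; [lra| |subst; lra].
  left; apply exp_increasing; auto.
Qed.

Lemma exp_lipschitz (x y : R) :
  Rabs x <= 1 -> Rabs y <= 1 -> Rabs (exp x - exp y) <= 3 * Rabs (x - y).
Proof.
  intros hx hy.
  destruct (MVT_gen exp y x exp) as [c [hc e]].
  - intros; apply is_derive_exp.
  - intros; apply derivable_continuous_pt, derivable_pt_exp.
  - rewrite e, Rabs_mult. apply Rmult_le_compat_r; [apply Rabs_pos|].
    rewrite Rabs_pos_eq by (left; apply exp_pos).
    apply exp_le_3_of_abs_le_1. apply Rabs_le_between in hx, hy.
    apply Rabs_le_between. unfold Rmin, Rmax in hc. destruct (Rle_dec y x); lra.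
Qed.

Lemma prod_diff_le (p1 q1 p2 q2 bp bq dp dq : R) :
  Rabs p1 <= bp -> Rabs q2 <= bq -> Rabs (p1 - p2) <= dp ->
  Rabs (q1 - q2) <= dq -> Rabs (p1 * q1 - p2 * q2) <= bp * dq + bq * dp.
Proof.
  intros h1 h2 h3 h4.
  replace (p1 * q1 - p2 * q2) with (p1 * (q1 - q2) + q2 * (p1 - p2)) by ring.
  eapply Rle_trans; [apply Rabs_triang|]. rewrite !Rabs_mult.
  apply Rplus_le_compat; apply Rmult_le_compat; auto using Rabs_pos.
Qed.

Lemma abs_RInt_le (f : R -> R) (a b M : R) :
  cts f -> (forall r, Rabs (f r) <= M) -> Rabs (RInt f a b) <= Rabs (b - a) * M.
Proof.
  intros hf hM. rewrite (RInt_unit f a b hf), Rabs_mult.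
  apply Rmult_le_compat_l; [apply Rabs_pos|].
  replace M with ((1 - 0) * M) by ring. apply abs_RInt_le_const; [lra| |auto].
  apply ex_RInt_cts. apply (cts_comp f (fun th => a + th * (b - a))); auto.
  apply cts_plus; [|apply cts_mult]; auto using cts_const, cts_id.
Qed.

(** The endpoint [z] may be any real, since [beta1 * x] is not confined to [0,1]; the vanishing of
    [f] outside (0,1) leaves an interval of effective length at most 1. *)
Lemma abs_RInt_to_1_le (f : R -> R) (M z : R) :
  cts f -> (forall r, Rabs (f r) <= M) ->
  (forall r, r <= 0 \/ 1 <= r -> f r = 0) -> Rabs (RInt f z 1) <= M.
Proof.
  intros hf hM h0.
  assert (hM0 : 0 <= M) by (eapply Rle_trans; [apply Rabs_pos|apply (hM 0)]).
  assert (hz : forall u v, (forall r, Rmin u v < r < Rmax u v -> f r = 0) ->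
                      RInt f u v = 0).
  { intros u v h. rewrite (RInt_ext f (fun _ => 0)) by auto.
    rewrite RInt_const. apply Rmult_0_r. }
  assert (h1 : forall w, 0 <= w <= 1 -> Rabs (RInt f w 1) <= M).
  { intros w hw. eapply Rle_trans.
    - apply (abs_RInt_le f w 1 M); auto.
    - rewrite Rabs_pos_eq by lra. nra. }
  destruct (Rle_dec 1 z) as [hz1|hz1].
  - rewrite hz; [rewrite Rabs_R0; auto|]. intros r hr. apply h0. right.
    rewrite Rmin_right in hr by lra. lra.
  - destruct (Rle_dec 0 z); [apply h1; lra|].
    rewrite <- (RInt_Chasles f z 0 1) by (apply ex_RInt_cts; auto).
    rewrite hz.
    + change (Rabs (0 + RInt f 0 1) <= M). rewrite Rplus_0_l. apply h1; lra.
    + intros r hr. apply h0. left. rewrite Rmax_right in hr by lra. lra.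
Qed.

(* Clamping makes everything defined and continuous for all real times, so that
   no derivative or continuity has to be taken within [0,T]. *)
Definition clamp (T t : R) : R := Rmax 0 (Rmin t T).

Lemma clamp_in T t : 0 <= T -> 0 <= clamp T t <= T.
Proof.
  intros h; unfold clamp, Rmax, Rmin.
  destruct (Rle_dec t T); destruct (Rle_dec 0 _); lra.
Qed.

Lemma clamp_id T t : 0 <= t <= T -> clamp T t = t.
Proof. intros h; unfold clamp. rewrite Rmin_left, Rmax_right; lra. Qed.

Lemma cts_clamp T : cts (clamp T).
Proof. apply cts_Rmax; [|apply cts_Rmin]; auto using cts_const, cts_id. Qed.

Lemma Hadamard (f f' : R -> R) (y y' : R) :
  cts f' -> (forall z, is_derive f z (f' z)) ->
  f y' - f y = (y' - y) * RInt (fun th => f' (y + th * (y' - y))) 0 1.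
Proof.
  intros hc hd. rewrite <- RInt_unit by auto. symmetry.
  apply is_RInt_unique, (is_RInt_derive f f'); auto.
Qed.

(** Caratheodory's form of differentiability: a slope function continuous at [x] avoids dividing by
    the increment. *)
Lemma is_derive_of_quotient (f H : R -> R) (x : R) :
  continuous H x -> (forall y, f y - f x = (y - x) * H y) ->
  is_derive f x (H x).
Proof.
  intros hc he. apply is_derive_Reals. intros eps heps.
  destruct (proj1 (filterlim_locally _ _) hc (mkposreal _ heps)) as [d hd].
  exists d. intros h hh0 hh.
  replace ((f (x + h) - f x) / h) with (H (x + h)).
  2:{ rewrite he. field; auto. }
  apply hd. change (Rabs (x + h - x) < d). replace (x + h - x) with h by ring. auto.
Qed.

(** The integrand varies with [tau] as well, but at [tau = t] the interval has length zero. The mean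
    of [f tau] over it is a continuous slope, so joint continuity gives the derivative. *)
Lemma is_derive_RInt_diag (f : R -> R -> R) (t : R) :
  jcont f -> is_derive (fun tau => RInt (f tau) t tau) t (f t t).
Proof.
  intros hf.
  set (H := fun tau => RInt (fun th => f tau (t + th * (tau - t))) 0 1).
  assert (e : H t = f t t).
  { unfold H. rewrite (RInt_ext _ (fun _ => f t t)).
    - rewrite RInt_const. change ((1 - 0) * f t t = f t t). ring.
    - intros th _. f_equal. ring. }
  rewrite <- e. apply is_derive_of_quotient.
  - apply (continuous_RInt_param (fun th tau => f tau (t + th * (tau - t)))); [lra|].
    apply (cts_comp _ (fun z : R * R => (snd z, t + fst z * (snd z - t))) hf).
    apply cts_pair; auto using cts_snd.
    apply cts_plus; [apply cts_const|]. apply cts_mult; [apply cts_fst|].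
    apply cts_minus; auto using cts_snd, cts_const.
  - intros y. rewrite (RInt_point t (f t)). change zero with 0.
    rewrite Rminus_0_r. apply RInt_unit.
    apply (jcont_at 0 f (jcont_CC0 f hf)).
Qed.

Section Flow.

Context (beta1 beta2 T : R) (g0 h0 : R -> R).

(* [Z (t, s) x] encodes the position [x * exp (- Z (t, s) x)] at time [s] of the
   particle which is at [x] at time [t]; the exponential form keeps it positive
   without any side condition.  [gE] is omega(x,t)/x, with g0 = omega0(x)/x and
   h0 = rho0(x)/x^2. *)
Definition Yof (Z : R * R -> R -> R) (p : R * R) (x : R) : R := x * exp (- Z p x).

Definition gE (Z : R * R -> R -> R) (t x : R) : R :=
  g0 (Yof Z (t, 0) x) * exp (- Z (t, 0) x) +
  h0 (Yof Z (t, 0) x) * (exp (- Z (t, 0) x) * exp (- Z (t, 0) x)) *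
    RInt (fun s => exp (Z (t, s) x)) 0 (clamp T t).

Definition WE (Z : R * R -> R -> R) (t z : R) : R := RInt (gE Z t) z 1.

(** With [WE] the integral of omega/y from [z] to 1, the two integrals in the velocity are
    [WE (beta2 x) - WE (beta1 x)] and [WE (beta1 x)]; hence the coefficient 2. *)
Definition vE (Z : R * R -> R -> R) (t x : R) : R :=
  WE Z t (beta2 * x) - 2 * WE Z t (beta1 * x).

Definition Psi (Z : R * R -> R -> R) (p : R * R) (x : R) : R :=
  RInt (fun r => vE Z r (Yof Z (fst p, r) x)) (clamp T (snd p)) (clamp T (fst p)).

Lemma CC_Yof k Z : CC k Z -> CC k (Yof Z).
Proof.
  intros h. apply (CC_mult k (fun _ x => x)); [apply CC_id|].
  apply CC_exp, CC_opp, h.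
Qed.

Lemma CC_gE k Z : CC k (fun _ : R => g0) -> CC k (fun _ : R => h0) ->
  CC k Z -> CC k (gE Z).
Proof.
  intros hg hh hZ.
  assert (h1 : cts (fun t : R => (t, 0))) by (apply cts_pair; auto using cts_id, cts_const).
  assert (hZ1 := CC_reparam k Z (fun t => (t, 0)) hZ h1).
  assert (hY1 := CC_reparam k _ (fun t => (t, 0)) (CC_Yof k Z hZ) h1).
  assert (he := CC_exp k _ (CC_opp k _ hZ1)).
  apply CC_plus; [|apply CC_mult; [|]].
  - apply CC_mult; auto. apply (CC_comp k (fun _ : R => g0)); auto.
  - apply CC_mult; [|apply CC_mult; auto].
    apply (CC_comp k (fun _ : R => h0)); auto.
  - apply (CC_RInt k (fun (q : R * R) x => exp (Z (snd q, fst q) x))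
             (fun _ => 0) (clamp T)); auto using cts_const, cts_clamp.
    apply CC_exp. apply (CC_reparam k Z (fun q => (snd q, fst q))); auto.
    apply cts_pair; auto using cts_fst, cts_snd.
Qed.

Lemma CC_vE k Z : CC k (fun _ : R => g0) -> CC k (fun _ : R => h0) ->
  CC k Z -> CC (S k) (vE Z).
Proof.
  intros hg hh hZ. assert (hW := CC_primitive k _ (CC_gE k Z hg hh hZ)).
  assert (hs : forall c, CC (S k) (fun t x => WE Z t (c * x))).
  { intros c. apply (CC_comp (S k) (WE Z) (fun _ x => c * x)); auto.
    apply (CC_mult (S k) (fun _ _ => c)); auto using CC_const, CC_id. }
  apply CC_minus; auto. apply (CC_mult (S k) (fun _ _ => 2)); auto using CC_const.
Qed.

(** In the parameter [(r, (t, s))], [r] is the integration time and [(t, s)] the argument of [Z];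
    carrying [s] along gives the shape that [CC_RInt] expects. *)
Lemma CC_along_flow k (w : R -> R -> R) Z : CC k w -> CC k (Yof Z) ->
  CC k (fun (q : R * (R * R)) x => w (fst q) (Yof Z (fst (snd q), fst q) x)).
Proof.
  intros hv hY.
  apply (CC_comp k (fun q : R * (R * R) => w (fst q))
           (fun q => Yof Z (fst (snd q), fst q))).
  - apply (CC_reparam k w fst); auto using cts_fst.
  - apply (CC_reparam k (Yof Z) (fun q : R * (R * R) => (fst (snd q), fst q))); auto.
    apply cts_pair; auto using cts_fst.
    apply (cts_comp fst snd); auto using cts_fst, cts_snd.
Qed.

Lemma CC_RInt_along_flow k (w : R -> R -> R) Z : CC k w -> CC k (Yof Z) ->
  CC k (fun p x => RInt (fun r => w r (Yof Z (fst p, r) x))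
                     (clamp T (snd p)) (clamp T (fst p))).
Proof.
  intros hv hY. apply (CC_RInt k _ (fun p : R * R => clamp T (snd p))
                         (fun p => clamp T (fst p)) (CC_along_flow k w Z hv hY));
  apply (cts_comp (clamp T)); auto using cts_clamp, cts_fst, cts_snd.
Qed.

(** * A priori bounds and the contraction estimate *)

Context (a b kap G L : R).
Context (hT : 0 < T <= 1) (ha : 0 < a) (hb : 0 < b) (hkap : 0 < kap <= 1)
  (hbk : b * exp kap < 1)
  (g0c : CC 0 (fun _ : R => g0)) (h0c : CC 0 (fun _ : R => h0))
  (g0b : forall x, Rabs (g0 x) <= G) (h0b : forall x, Rabs (h0 x) <= G)
  (g0l : forall x y, Rabs (g0 x - g0 y) <= L * Rabs (x - y))
  (h0l : forall x y, Rabs (h0 x - h0 y) <= L * Rabs (x - y))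
  (g0z : forall x, x < a \/ b < x -> g0 x = 0)
  (h0z : forall x, x < a \/ b < x -> h0 x = 0).

(* [K] bounds [gE] and [C] is its Lipschitz constant with respect to [Z], both
   computed from |Z| <= 1, T <= 1 and exp 1 <= 3. *)
Let K := 30 * G.
Let C := 90 * L + 84 * G.

Context (hTk : T * (3 * K) <= kap) (hTc : T * (3 * K + 3 * C) <= / 2).

(** The bound [kap] acts twice: being at most 1, it bounds all exponentials by 3, and through
    [b * exp kap < 1] it keeps the transported supports below 1. *)
Definition good (Z : R * R -> R -> R) : Prop :=
  jcont Z /\ forall p x, Rabs (Z p x) <= kap.

Lemma G_nonneg : 0 <= G.
Proof. eapply Rle_trans; [apply Rabs_pos|apply (g0b 0)]. Qed.

Lemma L_nonneg : 0 <= L.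
Proof.
  assert (h := g0l 1 0). rewrite Rminus_0_r, Rabs_R1 in h.
  assert (h' := Rabs_pos (g0 1 - g0 0)). lra.
Qed.

Lemma good_1 Z p x : good Z -> Rabs (Z p x) <= 1.
Proof. intros [_ h]. specialize (h p x). lra. Qed.

Lemma exp_good Z p x : good Z -> 0 < exp (Z p x) <= 3.
Proof. intros h; apply exp_le_3_of_abs_le_1, good_1, h. Qed.

Lemma exp_opp_good Z p x : good Z -> 0 < exp (- Z p x) <= 3.
Proof.
  intros h; apply exp_le_3_of_abs_le_1. rewrite Rabs_Ropp. apply good_1, h.
Qed.

Lemma clamp_T t : 0 <= clamp T t <= T.
Proof. apply clamp_in; lra. Qed.

(** A particle moves by a factor between [exp (- kap)] and [exp kap], so one that starts in [[a, b]]
    stays in the enlarged interval. For [x <= 0] the position is not positive, hence below [a]. *)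
Lemma Yof_outside Z p x : good Z ->
  x < a * exp (- kap) \/ b * exp kap < x ->
  Yof Z p x < a \/ b < Yof Z p x.
Proof.
  intros [_ hZ] hx. specialize (hZ p x). apply Rabs_le_between in hZ.
  unfold Yof.
  assert (e1 : exp (- Z p x) <= exp kap).
  { destruct (Rle_lt_or_eq_dec (- Z p x) kap) as [h|h]; [lra| |rewrite h; lra].
    left; apply exp_increasing; auto. }
  assert (e2 : exp (- kap) <= exp (- Z p x)).
  { destruct (Rle_lt_or_eq_dec (- kap) (- Z p x)) as [h|h]; [lra| |rewrite h; lra].
    left; apply exp_increasing; auto. }
  assert (e3 : exp (- kap) * exp kap = 1).
  { rewrite <- exp_plus, Rplus_opp_l, exp_0; auto. }
  assert (p1 := exp_pos (- kap)). assert (p2 := exp_pos kap).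
  assert (p3 := exp_pos (- Z p x)).
  destruct hx as [hx|hx]; [left|right].
  - destruct (Rle_dec x 0) as [h0x|h0x].
    + apply Rle_lt_trans with 0; [nra|auto].
    + apply Rle_lt_trans with (x * exp kap); [nra|].
      replace a with (a * exp (- kap) * exp kap) by (rewrite Rmult_assoc, e3; ring).
      apply Rmult_lt_compat_r; auto.
  - assert (hx0 : 0 < x) by (assert (0 < b * exp kap) by nra; lra).
    apply Rlt_le_trans with (x * exp (- kap)); [|nra].
    replace b with (b * exp kap * exp (- kap)).
    + apply Rmult_lt_compat_r; auto.
    + rewrite Rmult_assoc, (Rmult_comm (exp kap)), e3; ring.
Qed.

Lemma gE_zero Z t x : good Z ->
  x < a * exp (- kap) \/ b * exp kap < x -> gE Z t x = 0.
Proof.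
  intros hZ hx. unfold gE. assert (h := Yof_outside Z (t, 0) x hZ hx).
  rewrite g0z, h0z by auto. ring.
Qed.

Lemma gE_zero_01 Z t x : good Z -> x <= 0 \/ 1 <= x -> gE Z t x = 0.
Proof.
  intros hZ hx. apply gE_zero; auto.
  assert (p1 := exp_pos (- kap)). destruct hx; [left|right]; [nra|lra].
Qed.

Lemma good_CC Z : good Z -> CC 0 Z.
Proof. intros [h _]; apply jcont_CC0, h. Qed.

Lemma cts_gE Z t : good Z -> cts (gE Z t).
Proof. intros h; apply (jcont_at 0 (gE Z)), CC_gE; auto using good_CC. Qed.

Lemma cts_exp_time Z t x : good Z -> cts (fun s => exp (Z (t, s) x)).
Proof.
  intros [h _]. apply cts_exp. apply (cts_comp _ (fun s : R => ((t, s), x)) h).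
  repeat apply cts_pair; auto using cts_const, cts_id.
Qed.

Lemma time_factor_bound Z t x : good Z ->
  Rabs (RInt (fun s => exp (Z (t, s) x)) 0 (clamp T t)) <= 3.
Proof.
  intros h. eapply Rle_trans.
  - apply (abs_RInt_le _ _ _ 3); [apply cts_exp_time; auto|].
    intros s. destruct (exp_good Z (t, s) x h). rewrite Rabs_pos_eq; lra.
  - assert (e := clamp_T t). rewrite Rabs_pos_eq; lra.
Qed.

Lemma gE_bound Z t x : good Z -> Rabs (gE Z t x) <= K.
Proof.
  intros h. unfold gE, K. set (Y := Yof Z (t, 0) x).
  assert (e := time_factor_bound Z t x h).
  set (I := RInt _ _ _) in *. clearbody I.
  destruct (exp_opp_good Z (t, 0) x h) as [e1 e2].
  set (ee := exp (- Z (t, 0) x)) in *. clearbody ee.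
  eapply Rle_trans; [apply Rabs_triang|]. rewrite !Rabs_mult.
  rewrite (Rabs_pos_eq ee) by lra.
  assert (k1 := g0b Y). assert (k2 := h0b Y).
  assert (hG := G_nonneg).
  assert (p1 := Rabs_pos (g0 Y)). assert (p2 := Rabs_pos (h0 Y)).
  assert (p3 := Rabs_pos I).
  (* The two terms of [gE] contribute [3 * G] and [27 * G], which is [K]. *)
  assert (s1 : Rabs (g0 Y) * ee <= G * 3) by (apply Rmult_le_compat; lra).
  assert (s2 : Rabs (h0 Y) * (ee * ee) * Rabs I <= G * (3 * 3) * 3).
  { apply Rmult_le_compat; try lra; [nra|].
    apply Rmult_le_compat; try lra; [nra|]. apply Rmult_le_compat; lra. }
  lra.
Qed.

Lemma gE_diff Z1 Z2 d t x : good Z1 -> good Z2 ->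
  (forall p x, Rabs (Z1 p x - Z2 p x) <= d) ->
  Rabs (gE Z1 t x - gE Z2 t x) <= C * d.
Proof.
  intros h1 h2 hd.
  assert (hG := G_nonneg). assert (hL := L_nonneg).
  assert (hd0 : 0 <= d) by (eapply Rle_trans; [apply Rabs_pos|apply (hd (0,0) 0)]).
  assert (hC : 0 <= C) by (unfold C; lra).
  (* Outside (0,1) both functions vanish. Inside, the factor [x] of [Yof] is at most 1, which makes
     the estimate uniform in [x]. *)
  destruct (Rle_dec x 0) as [hx|hx];
    [rewrite !gE_zero_01, Rminus_0_r, Rabs_R0 by auto; nra|].
  destruct (Rle_dec 1 x) as [hx'|hx'];
    [rewrite !gE_zero_01, Rminus_0_r, Rabs_R0 by auto; nra|].
  assert (hde : Rabs (exp (- Z1 (t, 0) x) - exp (- Z2 (t, 0) x)) <= 3 * d).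
  { eapply Rle_trans.
    - apply exp_lipschitz; rewrite Rabs_Ropp; apply good_1; auto.
    - replace (- Z1 (t, 0) x - - Z2 (t, 0) x) with (- (Z1 (t, 0) x - Z2 (t, 0) x)) by ring.
      rewrite Rabs_Ropp. specialize (hd (t, 0) x). lra. }
  assert (hdY : Rabs (Yof Z1 (t, 0) x - Yof Z2 (t, 0) x) <= 3 * d).
  { unfold Yof. rewrite <- Rmult_minus_distr_l, Rabs_mult, (Rabs_pos_eq x) by lra.
    assert (q := Rabs_pos (exp (- Z1 (t, 0) x) - exp (- Z2 (t, 0) x))). nra. }
  assert (hdI : Rabs (RInt (fun s => exp (Z1 (t, s) x)) 0 (clamp T t) -
                      RInt (fun s => exp (Z2 (t, s) x)) 0 (clamp T t)) <= 3 * d).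
  { assert (c1 := cts_exp_time Z1 t x h1). assert (c2 := cts_exp_time Z2 t x h2).
    match goal with |- Rabs ?e <= _ => replace e with
      (RInt (fun s => exp (Z1 (t, s) x) - exp (Z2 (t, s) x)) 0 (clamp T t)) end.
    2:{ apply (RInt_minus (fun s => exp (Z1 (t, s) x)) (fun s => exp (Z2 (t, s) x)));
        apply ex_RInt_cts; auto. }
    eapply Rle_trans.
    - apply (abs_RInt_le _ _ _ (3 * d)); [apply cts_minus; auto|].
      intros s. eapply Rle_trans; [apply exp_lipschitz; apply good_1; auto|].
      specialize (hd (t, s) x). lra.
    - assert (e := clamp_T t). rewrite Rabs_pos_eq by lra. nra. }
  assert (b1 := time_factor_bound Z1 t x h1).
  assert (b2 := time_factor_bound Z2 t x h2).
  unfold gE.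
  set (I1 := RInt (fun s => exp (Z1 _ _)) _ _) in *. clearbody I1.
  set (I2 := RInt (fun s => exp (Z2 _ _)) _ _) in *. clearbody I2.
  destruct (exp_opp_good Z1 (t, 0) x h1) as [l1 u1].
  destruct (exp_opp_good Z2 (t, 0) x h2) as [l2 u2].
  set (Y1 := Yof Z1 _ _) in *. set (Y2 := Yof Z2 _ _) in *.
  set (e1 := exp (- Z1 _ _)) in *. set (e2 := exp (- Z2 _ _)) in *.
  clearbody Y1 Y2 e1 e2.
  assert (a1 : Rabs e1 <= 3) by (rewrite Rabs_pos_eq; lra).
  assert (a2 : Rabs e2 <= 3) by (rewrite Rabs_pos_eq; lra).
  assert (hlip : forall f : R -> R, (forall x y, Rabs (f x - f y) <= L * Rabs (x - y)) ->
            Rabs (f Y1 - f Y2) <= 3 * L * d).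
  { intros f hf. eapply Rle_trans; [apply hf|].
    replace (3 * L * d) with (L * (3 * d)) by ring.
    apply Rmult_le_compat_l; auto. }
  (* The first term of [gE] costs [(9 * L + 3 * G) * d], the second, built up one factor at a time,
     [(81 * L + 81 * G) * d]; the sum is [C * d]. *)
  assert (s1 := prod_diff_le _ e1 _ e2 _ _ _ _ (g0b Y1) a2 (hlip _ g0l) hde).
  assert (s2 := prod_diff_le e1 e1 e2 e2 _ _ _ _ a1 a2 hde hde).
  assert (a3 : Rabs (e2 * e2) <= 9).
  { rewrite Rabs_pos_eq; nra. }
  assert (s3 := prod_diff_le _ (e1 * e1) _ (e2 * e2) _ _ _ _ (h0b Y1) a3 (hlip _ h0l) s2).
  assert (a4 : Rabs (h0 Y1 * (e1 * e1)) <= G * 9).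
  { rewrite Rabs_mult. apply Rmult_le_compat; auto using Rabs_pos.
    rewrite Rabs_pos_eq; nra. }
  assert (s4 := prod_diff_le _ I1 _ I2 _ _ _ _ a4 b2 s3 hdI).
  match goal with |- Rabs ?e <= _ => replace e with
    ((g0 Y1 * e1 - g0 Y2 * e2) +
     (h0 Y1 * (e1 * e1) * I1 - h0 Y2 * (e2 * e2) * I2)) by ring end.
  eapply Rle_trans; [apply Rabs_triang|]. unfold C. lra.
Qed.

Lemma WE_bound Z t z : good Z -> Rabs (WE Z t z) <= K.
Proof.
  intros h. apply abs_RInt_to_1_le; auto using cts_gE, gE_bound, gE_zero_01.
Qed.

Lemma vE_bound Z t x : good Z -> Rabs (vE Z t x) <= 3 * K.
Proof.
  intros h. unfold vE, Rminus. eapply Rle_trans; [apply Rabs_triang|].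
  rewrite Rabs_Ropp, Rabs_mult, (Rabs_pos_eq 2) by lra.
  assert (h1 := WE_bound Z t (beta2 * x) h). assert (h2 := WE_bound Z t (beta1 * x) h).
  lra.
Qed.

Lemma WE_diff Z1 Z2 d t z : good Z1 -> good Z2 ->
  (forall p x, Rabs (Z1 p x - Z2 p x) <= d) ->
  Rabs (WE Z1 t z - WE Z2 t z) <= C * d.
Proof.
  intros h1 h2 hd. unfold WE.
  replace (RInt (gE Z1 t) z 1 - RInt (gE Z2 t) z 1)
    with (RInt (fun r => gE Z1 t r - gE Z2 t r) z 1).
  2:{ apply (RInt_minus (gE Z1 t) (gE Z2 t)); apply ex_RInt_cts, cts_gE; auto. }
  apply abs_RInt_to_1_le.
  - apply cts_minus; apply cts_gE; auto.
  - intros; apply gE_diff; auto.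
  - intros r hr. rewrite !gE_zero_01 by auto. ring.
Qed.

Lemma vE_diff Z1 Z2 d t x : good Z1 -> good Z2 ->
  (forall p x, Rabs (Z1 p x - Z2 p x) <= d) ->
  Rabs (vE Z1 t x - vE Z2 t x) <= 3 * C * d.
Proof.
  intros h1 h2 hd. unfold vE.
  assert (e1 := WE_diff Z1 Z2 d t (beta2 * x) h1 h2 hd).
  assert (e2 := WE_diff Z1 Z2 d t (beta1 * x) h1 h2 hd).
  match goal with |- Rabs ?e <= _ => replace e with
    ((WE Z1 t (beta2 * x) - WE Z2 t (beta2 * x)) -
     2 * (WE Z1 t (beta1 * x) - WE Z2 t (beta1 * x))) by ring end.
  unfold Rminus at 1. eapply Rle_trans; [apply Rabs_triang|].
  rewrite Rabs_Ropp, Rabs_mult, (Rabs_pos_eq 2) by lra. lra.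
Qed.

(** The derivative in [z] is [Y * gE Z t Y] at [Y = y * exp (- z)], and [Y] lies in (0,1) wherever
    [gE] is nonzero. So in the logarithmic variable the bound [K] of [gE] is also a Lipschitz
    constant, whatever the size of [y]. *)
Lemma WE_log_lipschitz Z t y z1 z2 : good Z ->
  Rabs (WE Z t (y * exp (- z1)) - WE Z t (y * exp (- z2))) <= K * Rabs (z1 - z2).
Proof.
  intros h.
  assert (hd : forall z, is_derive (fun z => WE Z t (y * exp (- z))) z
             (gE Z t (y * exp (- z)) * (y * exp (- z)))).
  { intros z.
    replace (gE Z t (y * exp (- z)) * (y * exp (- z))) with
      (- (y * exp (- z)) * - gE Z t (y * exp (- z))) by ring.
    apply (is_derive_comp (WE Z t) (fun z => y * exp (- z))).
    - apply is_derive_RInt_lower, cts_gE, h.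
    - auto_derive; auto. ring. }
  destruct (MVT_gen (fun z => WE Z t (y * exp (- z))) z2 z1 _ (fun z _ => hd z))
    as [c [_ e]].
  { intros z _. apply continuity_pt_filterlim.
    apply (ex_derive_continuous (fun z => WE Z t (y * exp (- z)))).
    eexists; apply hd. }
  rewrite e, Rabs_mult. apply Rmult_le_compat_r; [apply Rabs_pos|].
  set (Y := y * exp (- c)). clearbody Y.
  destruct (Rle_dec Y 0) as [hY|hY].
  { rewrite gE_zero_01, Rmult_0_l, Rabs_R0 by auto. unfold K; assert (q := G_nonneg); lra. }
  destruct (Rle_dec 1 Y) as [hY'|hY'].
  { rewrite gE_zero_01, Rmult_0_l, Rabs_R0 by auto. unfold K; assert (q := G_nonneg); lra. }
  rewrite Rabs_mult, (Rabs_pos_eq Y) by lra.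
  assert (q := gE_bound Z t Y h). assert (q' := Rabs_pos (gE Z t Y)). nra.
Qed.

Lemma vE_log_lipschitz Z t x z1 z2 : good Z ->
  Rabs (vE Z t (x * exp (- z1)) - vE Z t (x * exp (- z2))) <= 3 * K * Rabs (z1 - z2).
Proof.
  intros h. unfold vE.
  rewrite <- !Rmult_assoc.
  assert (e1 := WE_log_lipschitz Z t (beta2 * x) z1 z2 h).
  assert (e2 := WE_log_lipschitz Z t (beta1 * x) z1 z2 h).
  match goal with |- Rabs (?p - ?q - (?p' - ?q')) <= _ =>
    replace (p - q - (p' - q')) with ((p - p') - (q - q')) by ring end.
  unfold Rminus at 1. eapply Rle_trans; [apply Rabs_triang|].
  rewrite Rabs_Ropp. rewrite <- Rmult_minus_distr_l, Rabs_mult, (Rabs_pos_eq 2) by lra.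
  lra.
Qed.

Lemma clamp_dist t s : Rabs (clamp T t - clamp T s) <= T.
Proof.
  assert (h1 := clamp_T t). assert (h2 := clamp_T s).
  apply Rabs_le_between; lra.
Qed.

Lemma good_vE_Yof Z t x : good Z -> cts (fun r => vE Z r (Yof Z (t, r) x)).
Proof.
  intros h. assert (hc := good_CC _ h).
  assert (h1 := CC_along_flow 0 _ Z (CC_pred _ _ (CC_vE 0 Z g0c h0c hc)) (CC_Yof 0 Z hc)).
  apply (cts_comp _ (fun r : R => ((r, (t, 0)), x)) (CC_jcont _ _ h1)).
  repeat apply cts_pair; auto using cts_const, cts_id.
Qed.

Lemma good_Psi Z : good Z -> good (Psi Z).
Proof.
  intros h. assert (hc := good_CC _ h). split.
  - apply (CC_jcont 0). apply CC_RInt_along_flow; auto using CC_Yof, CC_pred, CC_vE.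
  - intros p x. eapply Rle_trans; [|apply hTk]. unfold Psi.
    eapply Rle_trans.
    + apply (abs_RInt_le _ _ _ (3 * K)); [apply good_vE_Yof; auto|].
      intros; apply vE_bound; auto.
    + apply Rmult_le_compat_r; [unfold K; assert (q := G_nonneg); lra|].
      apply clamp_dist.
Qed.

(** Replacing [Z1] by [Z2] moves the point at which the velocity is evaluated, at cost [3 * K * d],
    and changes the velocity itself, at cost [3 * C * d]. Integration over a time at most [T] and
    [hTc] give the factor 1/2. *)
Lemma Psi_contraction Z1 Z2 d : good Z1 -> good Z2 ->
  (forall p x, Rabs (Z1 p x - Z2 p x) <= d) ->
  forall p x, Rabs (Psi Z1 p x - Psi Z2 p x) <= d * / 2.
Proof.
  intros h1 h2 hd p x.
  assert (hG := G_nonneg). assert (hL := L_nonneg).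
  assert (hd0 : 0 <= d) by (eapply Rle_trans; [apply Rabs_pos|apply (hd (0,0) 0)]).
  assert (c1 := good_vE_Yof Z1 (fst p) x h1). assert (c2 := good_vE_Yof Z2 (fst p) x h2).
  unfold Psi. match goal with |- Rabs (RInt ?f ?u ?v - RInt ?g ?u ?v) <= _ =>
    replace (RInt f u v - RInt g u v) with (RInt (fun r => f r - g r) u v)
    by (apply (RInt_minus f g); apply ex_RInt_cts; auto) end.
  eapply Rle_trans.
  - apply (abs_RInt_le _ _ _ ((3 * K + 3 * C) * d)); [apply cts_minus; auto|].
    intros r. set (y2 := Yof Z2 (fst p, r) x).
    replace (vE Z1 r (Yof Z1 (fst p, r) x) - vE Z2 r y2) with
      ((vE Z1 r (Yof Z1 (fst p, r) x) - vE Z1 r y2) + (vE Z1 r y2 - vE Z2 r y2)) by ring.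
    eapply Rle_trans; [apply Rabs_triang|].
    assert (e1 := vE_diff Z1 Z2 d r y2 h1 h2 hd).
    assert (e2 := vE_log_lipschitz Z1 r x (Z1 (fst p, r) x) (Z2 (fst p, r) x) h1).
    fold (Yof Z1 (fst p, r) x) (Yof Z2 (fst p, r) x) in e2. fold y2 in e2.
    assert (e3 : 3 * K * Rabs (Z1 (fst p, r) x - Z2 (fst p, r) x) <= 3 * K * d).
    { apply Rmult_le_compat_l; auto. unfold K; lra. }
    lra.
  - apply Rle_trans with (T * (3 * K + 3 * C) * d); [|nra].
    rewrite Rmult_assoc. apply Rmult_le_compat_r; [|apply clamp_dist].
    apply Rmult_le_pos; auto. unfold K, C; lra.
Qed.

Lemma flow_exists : exists Z, good Z /\ forall p x, Psi Z p x = Z p x.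
Proof.
  destruct (banach (A := (R * R) * R) (fun f => good (fun p x => f (p, x)))
    (fun f q => Psi (fun p x => f (p, x)) (fst q) (snd q)) (fun _ => 0) kap)
    as [f [h1 h2]].
  - split.
    + apply (CC_jcont 0 (fun (_ : R * R) _ => 0)), CC_const.
    + intros; rewrite Rabs_R0; lra.
  - intros f hf. apply (good_Psi _ hf).
  - intros f [p x] hf. apply hf.
  - intros f g d hf hg hd q. apply Psi_contraction; auto.
  - intros u f hu hf. split.
    + unfold jcont. apply (cts_uniform_limit
        (fun k (q : (R * R) * R) => u k (fst q, snd q)) _ (4 * kap)).
      * intros k; apply hu.
      * intros k q; apply hf.
    + intros p x.
      (* The bound [kap] survives the limit because [|f|] is at most [kap] plus an error that tends
         to 0. *)
      assert (hl : is_lim_seq (fun k => kap + 4 * kap * (/ 2) ^ k) (kap + 4 * kap * 0)).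
      { apply is_lim_seq_plus'; [apply is_lim_seq_const|].
        apply (is_lim_seq_scal_l _ (4 * kap) 0), is_lim_seq_geom.
        rewrite Rabs_pos_eq; lra. }
      rewrite Rmult_0_r, Rplus_0_r in hl.
      refine (is_lim_seq_le (fun _ => Rabs (f (p, x))) _ (Rabs (f (p, x))) kap _
                (is_lim_seq_const _) hl).
      intros k. assert (e1 := hf k (p, x)). assert (e2 := proj2 (hu k) p x).
      simpl in e2.
      replace (f (p, x)) with ((f (p, x) - u k (p, x)) + u k (p, x)) by ring.
      eapply Rle_trans; [apply Rabs_triang|]. lra.
  - exists (fun p x => f (p, x)). split; auto. intros p x. apply (h2 (p, x)).
Qed.

(** * The fixed point: regularity in x, semigroup law, and the equations *)

Context (Z : R * R -> R -> R) (hZ : good Z) (hfix : forall p x, Psi Z p x = Z p x).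

Lemma K_nonneg : 0 <= K.
Proof. unfold K. assert (h := G_nonneg). lra. Qed.

Lemma flow_eq t s x :
  Z (t, s) x = RInt (fun r => vE Z r (Yof Z (t, r) x)) (clamp T s) (clamp T t).
Proof. rewrite <- hfix; reflexivity. Qed.

Lemma flow_clamp t s x : Z (t, clamp T s) x = Z (t, s) x.
Proof. rewrite !flow_eq, (clamp_id T (clamp T s)); auto using clamp_T. Qed.

Lemma flow_diag t s x : clamp T t = clamp T s -> Z (t, s) x = 0.
Proof. intros h. rewrite flow_eq, h, RInt_point. reflexivity. Qed.

Lemma Yof_diag t s x : clamp T t = clamp T s -> Yof Z (t, s) x = x.
Proof. intros h. unfold Yof. rewrite flow_diag, Ropp_0, exp_0 by auto. ring. Qed.

Lemma locally_clamp_id r : 0 < r < T -> locally r (fun r' => clamp T r' = r').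
Proof.
  intros [h1 h2].
  assert (hd : 0 < Rmin r (T - r)) by (apply Rmin_glb_lt; lra).
  exists (mkposreal _ hd). intros y hy. change (Rabs (y - r) < Rmin r (T - r)) in hy.
  assert (q1 := Rmin_l r (T - r)). assert (q2 := Rmin_r r (T - r)).
  apply Rabs_lt_between in hy. apply clamp_id. lra.
Qed.

Lemma flow_time_derivative t r x : 0 < r < T ->
  is_derive (fun r => Z (t, r) x) r (- vE Z r (Yof Z (t, r) x)).
Proof.
  intros hr.
  apply is_derive_ext_loc with
    (fun r => RInt (fun r => vE Z r (Yof Z (t, r) x)) r (clamp T t)).
  - generalize (locally_clamp_id r hr). apply filter_imp.
    intros r' h. rewrite flow_eq, h. reflexivity.
  - apply (is_derive_RInt_lower (fun r => vE Z r (Yof Z (t, r) x))).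
    apply good_vE_Yof; auto.
Qed.

Lemma Yof_time_derivative t r x : 0 < r < T ->
  is_derive (fun r => Yof Z (t, r) x) r
    (Yof Z (t, r) x * vE Z r (Yof Z (t, r) x)).
Proof.
  intros hr. assert (h := flow_time_derivative t r x hr).
  set (v := vE Z r (Yof Z (t, r) x)) in *. clearbody v.
  unfold Yof.
  replace (x * exp (- Z (t, r) x) * v)
    with (x * (- (- v) * exp (- Z (t, r) x))) by ring.
  apply (is_derive_scal (fun r => exp (- Z (t, r) x))).
  apply (is_derive_comp exp (fun r => - Z (t, r) x)).
  - apply is_derive_exp.
  - apply (is_derive_opp (fun r => Z (t, r) x)). exact h.
Qed.

(* The difference D of two characteristics solves D' = m D, where m is the mean of
   [w = du/dx] between them (Hadamard).  So the difference quotient in x is the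
   exponential of an integral of m, which is continuous up to x' = x; in this form
   the flow inherits one derivative more than [w] has. *)
Lemma Yof_derivative (w : R -> R -> R) (hw : jcont w)
  (hu : forall r y, is_derive (fun y => y * vE Z r y) y (w r y)) t s x :
  is_derive (Yof Z (t, s)) x
    (exp (- RInt (fun r => w r (Yof Z (t, r) x)) (clamp T s) (clamp T t))).
Proof.
  assert (hY : CC 0 (Yof Z)) by (apply CC_Yof, good_CC, hZ).
  assert (hYt : CC 0 (fun r : R => Yof Z (t, r))).
  { apply (CC_reparam 0 (Yof Z) (fun r : R => (t, r))); auto.
    apply cts_pair; auto using cts_const, cts_id. }
  set (m := fun q x' => RInt (fun th =>
     w q (Yof Z (t, q) x + th * (Yof Z (t, q) x' - Yof Z (t, q) x))) 0 1).
  assert (hm : jcont m).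
  { apply (CC_jcont 0). apply (CC_RInt_unit 0 (fun z x' =>
      w (snd z) (Yof Z (t, snd z) x
        + fst z * (Yof Z (t, snd z) x' - Yof Z (t, snd z) x)))).
    assert (hp : cts (fun z : R * R => Yof Z (t, snd z) x)).
    { apply (cts_comp _ (fun z : R * R => (snd z, x)) (CC_jcont _ _ hYt)).
      apply cts_pair; auto using cts_snd, cts_const. }
    apply (CC_comp 0 (fun z : R * R => w (snd z))).
    - apply (CC_reparam 0 w); auto using cts_snd. apply jcont_CC0, hw.
    - apply CC_plus; [apply CC_param, hp|].
      apply CC_mult; [apply CC_param, cts_fst|].
      apply CC_minus; [|apply CC_param, hp].
      apply (CC_reparam 0 (fun r : R => Yof Z (t, r)) snd hYt), cts_snd. }
  assert (hmx : forall x', cts (fun q => m q x')).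
  { intros x'. apply (cts_comp _ (fun q : R => (q, x')) hm).
    apply cts_pair; auto using cts_const, cts_id. }
  set (H := fun x' => exp (- RInt (fun q => m q x') (clamp T s) (clamp T t))).
  assert (e : H x = exp (- RInt (fun r => w r (Yof Z (t, r) x)) (clamp T s) (clamp T t))).
  { unfold H. do 2 f_equal. apply RInt_ext. intros q _. unfold m.
    rewrite (RInt_ext _ (fun _ => w q (Yof Z (t, q) x))).
    - rewrite RInt_const. change ((1 - 0) * w q (Yof Z (t, q) x) = w q (Yof Z (t, q) x)).
      ring.
    - intros th _. f_equal. ring. }
  rewrite <- e. apply is_derive_of_quotient.
  { unfold H. apply cts_exp, cts_opp.
    apply (cts_RInt (fun q x' => m q x') (fun _ => clamp T s) (fun _ => clamp T t));
    auto using cts_const. }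
  intros x'.
  set (D := fun r => Yof Z (t, r) x' - Yof Z (t, r) x).
  set (I := fun r => RInt (fun q => m q x') r (clamp T t)).
  assert (hcY : forall y, cts (fun r => Yof Z (t, r) y)).
  { intros y. apply (cts_comp _ (fun r : R => (r, y)) (CC_jcont _ _ hYt)).
    apply cts_pair; auto using cts_const, cts_id. }
  assert (hI : forall r, is_derive I r (- m r x')).
  { intros r. apply (is_derive_RInt_lower (fun q => m q x')); auto. }
  (* [D * exp I] is an integrating-factor product with zero derivative, hence has equal values at
     the two ends. At time [t] this value is [x' - x], which gives [D = (x' - x) * H x'] at time
     [s]. The derivative is only needed at interior times, where the clamp is locally the
     identity. *)
  destruct (MVT_gen (fun r => D r * exp (I r)) (clamp T s) (clamp T t) (fun _ => 0))
    as [c [_ hc]].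
  - intros r hr.
    assert (hr' : 0 < r < T).
    { assert (q1 := clamp_T s). assert (q2 := clamp_T t).
      unfold Rmin, Rmax in hr. destruct (Rle_dec (clamp T s) (clamp T t)); lra. }
    assert (hD : is_derive D r (D r * m r x')).
    { unfold m, D.
      rewrite <- (Hadamard (fun y => y * vE Z r y) (w r)).
      - apply @is_derive_minus; apply Yof_time_derivative; auto.
      - apply (jcont_at 0 w), jcont_CC0, hw.
      - auto. }
    replace 0 with ((D r * m r x') * exp (I r) + D r * (- m r x' * exp (I r))) by ring.
    apply (is_derive_mult D (fun r => exp (I r))); auto.
    + apply (is_derive_comp exp I); auto. apply is_derive_exp.
    + intros; apply Rmult_comm.
  - intros r _. apply continuity_pt_filterlim.
    apply (cts_mult D (fun r => exp (I r))).
    + apply cts_minus; auto.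
    + apply cts_exp. intros r'. apply (ex_derive_continuous I). eexists; apply hI.
  - rewrite Rmult_0_l in hc.
    assert (hD1 : D (clamp T t) = x' - x).
    { unfold D. rewrite !Yof_diag; auto; rewrite (clamp_id T (clamp T t));
      auto using clamp_T. }
    assert (hI1 : I (clamp T t) = 0) by (unfold I; rewrite RInt_point; reflexivity).
    rewrite hD1, hI1, exp_0 in hc.
    assert (hD2 : D (clamp T s) = Yof Z (t, s) x' - Yof Z (t, s) x).
    { unfold D, Yof. rewrite !flow_clamp. reflexivity. }
    rewrite hD2 in hc. unfold H. fold (I (clamp T s)).
    replace (x' - x) with
      ((Yof Z (t, s) x' - Yof Z (t, s) x) * exp (I (clamp T s))) by lra.
    rewrite Rmult_assoc, <- exp_plus, Rplus_opp_r, exp_0. ring.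
Qed.

(** Two passes: the exponential formula, whose [w] is of class C^k, first makes [Yof Z] of class
    C^(k+1); then [Z] is recovered from [Psi Z = Z]. Solving [Y = x * exp (- Z)] for [Z] would break
    down at [x = 0]. *)
Lemma flow_CC_step k : CC k (fun _ : R => g0) -> CC k (fun _ : R => h0) ->
  CC k Z -> CC (S k) Z.
Proof.
  intros hg hh hk.
  assert (hv := CC_vE k Z hg hh hk).
  assert (hu : CC (S k) (fun r y => y * vE Z r y)).
  { apply (CC_mult (S k) (fun _ y => y)); auto using CC_id. }
  destruct hu as [_ [w [hw1 hw2]]].
  assert (hY : CC (S k) (Yof Z)).
  { apply CC_intro with (fun p x => exp (- RInt (fun r => w r (Yof Z (fst p, r) x))
                           (clamp T (snd p)) (clamp T (fst p)))).
    - apply (CC_jcont k), CC_Yof, hk.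
    - intros [t s] x. apply Yof_derivative; auto. apply (CC_jcont k), hw2.
    - apply CC_exp, CC_opp, CC_RInt_along_flow; auto using CC_Yof. }
  replace Z with (Psi Z).
  - apply CC_RInt_along_flow; auto.
  - apply functional_extensionality; intros p.
    apply functional_extensionality; intros x. apply hfix.
Qed.

Lemma flow_CC k : CC k (fun _ : R => g0) -> CC k (fun _ : R => h0) -> CC k Z.
Proof.
  induction k as [|k IH]; intros hg hh.
  - apply good_CC, hZ.
  - apply flow_CC_step; auto using CC_pred.
Qed.

(** As functions of [r], both sides follow the same velocity and agree at [r = s]. Their difference
    [D] is the integral of a velocity difference that is log-Lipschitz with constant [3 * K]; since
    [T * (3 * K) <= / 2], every use of the integral equation halves the bound on [D]. The initial
    bound 3 counts three values of [Z], each at most 1. *)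
Lemma flow_semigroup t s r x : 0 <= s <= T ->
  Z (t, r) x = Z (t, s) x + Z (s, r) (Yof Z (t, s) x).
Proof.
  intros hs. set (y := Yof Z (t, s) x).
  set (D := fun r => Z (t, r) x - (Z (t, s) x + Z (s, r) y)).
  assert (hL := L_nonneg). assert (hG := G_nonneg). assert (hK := K_nonneg).
  assert (hD : forall r, D r = RInt (fun q => vE Z q (Yof Z (t, q) x)
              - vE Z q (Yof Z (s, q) y)) (clamp T r) (clamp T s)).
  { intros r'. unfold D. rewrite !flow_eq.
    assert (c1 := good_vE_Yof Z t x hZ). assert (c2 := good_vE_Yof Z s y hZ).
    rewrite (RInt_minus (fun q => vE Z q (Yof Z (t, q) x))
               (fun q => vE Z q (Yof Z (s, q) y))) by (apply ex_RInt_cts; auto).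
    rewrite <- (RInt_Chasles _ (clamp T r') (clamp T s) (clamp T t))
      by (apply ex_RInt_cts; auto).
    unfold plus, minus, opp; simpl. unfold plus; simpl. ring. }
  assert (hb0 : forall k r, Rabs (D r) <= 3 * (/ 2) ^ k).
  { induction k as [|k IH]; intros r'.
    - unfold D. rewrite pow_O.
      assert (e1 := good_1 Z (t, r') x hZ). assert (e2 := good_1 Z (t, s) x hZ).
      assert (e3 := good_1 Z (s, r') y hZ).
      apply Rabs_le_between in e1, e2, e3. apply Rabs_le_between. lra.
    - rewrite hD.
      assert (hp : 0 <= (/ 2) ^ k) by (apply pow_le; lra).
      eapply Rle_trans.
      + apply (abs_RInt_le _ _ _ (3 * K * (3 * (/ 2) ^ k))).
        * apply cts_minus; apply good_vE_Yof; auto.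
        * intros q. assert (e := vE_log_lipschitz Z q x (Z (t, q) x)
                      (Z (t, s) x + Z (s, q) y) hZ).
          (* Both trajectories are written as the same [x] times an exponential, the form in which
             the log-Lipschitz bound applies. *)
          assert (ey : x * exp (- (Z (t, s) x + Z (s, q) y)) = Yof Z (s, q) y).
          { rewrite Ropp_plus_distr, exp_plus. unfold Yof at 1, y, Yof. ring. }
          rewrite ey in e. eapply Rle_trans; [exact e|].
          apply Rmult_le_compat_l; [lra|]. apply IH.
      + apply Rle_trans with (T * (3 * K * (3 * (/ 2) ^ k))).
        * apply Rmult_le_compat_r; [|apply clamp_dist].
          apply Rmult_le_pos; lra.
        * assert (hTK : T * (3 * K) <= / 2).
          { eapply Rle_trans; [|apply hTc]. apply Rmult_le_compat_l; [lra|].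
            unfold C; lra. }
          simpl pow. nra. }
  assert (h := half_contraction_zero 3 (D r) (fun k => hb0 k r)).
  unfold D in h. lra.
Qed.

Lemma Yof_semigroup t s r x : 0 <= s <= T ->
  Yof Z (t, r) x = Yof Z (s, r) (Yof Z (t, s) x).
Proof.
  intros hs. unfold Yof at 1 2. rewrite (flow_semigroup t s r x hs).
  rewrite Ropp_plus_distr, exp_plus. unfold Yof at 2. ring.
Qed.

(** At [tau = t] only the endpoint of the defining integral contributes, so no derivative of the
    trajectory in its starting time is presupposed. The semigroup law later carries this to the
    target time 0. *)
Lemma Yof_start_derivative t x : 0 < t < T ->
  is_derive (fun tau => Yof Z (tau, t) x) t (- (x * vE Z t x)).
Proof.
  intros ht.
  assert (hc : jcont (fun tau r => vE Z r (Yof Z (tau, r) x))).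
  { assert (hc := good_CC _ hZ).
    assert (h1 := CC_along_flow 0 _ Z (CC_pred _ _ (CC_vE 0 Z g0c h0c hc)) (CC_Yof 0 Z hc)).
    apply (cts_comp _ (fun z : R * R => ((snd z, (fst z, 0)), x)) (CC_jcont _ _ h1)).
    repeat apply cts_pair; auto using cts_const, cts_fst, cts_snd. }
  assert (h := is_derive_RInt_diag _ t hc). simpl in h.
  rewrite Yof_diag in h by reflexivity.
  assert (h' : is_derive (fun tau => Z (tau, t) x) t (vE Z t x)).
  { eapply is_derive_ext_loc; [|exact h].
    generalize (locally_clamp_id t ht). apply filter_imp.
    intros tau e. rewrite flow_eq, e, (clamp_id T t) by lra. reflexivity. }
  unfold Yof.
  replace (- (x * vE Z t x)) with (x * (- vE Z t x * exp (- Z (t, t) x))).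
  2:{ rewrite flow_diag by reflexivity. rewrite Ropp_0, exp_0. ring. }
  apply (is_derive_scal (fun tau => exp (- Z (tau, t) x))).
  apply (is_derive_comp exp (fun tau => - Z (tau, t) x)).
  - apply is_derive_exp.
  - apply (is_derive_opp (fun tau => Z (tau, t) x)). exact h'.
Qed.

(** By the semigroup law the profile at [tau] is the profile at [t] composed with [Yof Z (tau, t)];
    the chain rule at [tau = t] trades the time derivative for [- u] times the space derivative. *)
Lemma transported_equation (f : R -> R) t x l : 0 < t < T ->
  is_derive (fun y => f (Yof Z (t, 0) y)) x l ->
  is_derive (fun tau => f (Yof Z (tau, 0) x)) t (- (x * vE Z t x) * l).
Proof.
  intros ht hl.
  apply is_derive_ext with (fun tau => f (Yof Z (t, 0) (Yof Z (tau, t) x))).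
  { intros tau. rewrite <- Yof_semigroup by lra. reflexivity. }
  apply (is_derive_comp (fun y => f (Yof Z (t, 0) y)) (fun tau => Yof Z (tau, t) x)).
  - rewrite Yof_diag by reflexivity. exact hl.
  - apply Yof_start_derivative; auto.
Qed.

(** Duhamel's formula for omega = [x * gE] restarted at time [t]: the value at [t] transported to
    [tau], plus the source collected between [t] and [tau]. *)
Lemma gE_semigroup t tau x : 0 < t < T ->
  x * gE Z tau x = Yof Z (tau, t) x * gE Z t (Yof Z (tau, t) x) +
    RInt (fun s => x * h0 (Yof Z (tau, 0) x) *
                     (exp (- Z (tau, 0) x) * exp (- Z (tau, 0) x)) *
                     exp (Z (tau, s) x)) t (clamp T tau).
Proof.
  intros ht. set (y := Yof Z (tau, t) x). unfold gE at 1 2.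
  assert (e1 : Yof Z (t, 0) y = Yof Z (tau, 0) x).
  { unfold y. rewrite <- Yof_semigroup by lra. reflexivity. }
  rewrite e1.
  assert (e2 : y * exp (- Z (t, 0) y) = x * exp (- Z (tau, 0) x)).
  { exact e1. }
  rewrite (clamp_id T t) by lra.
  assert (e3 : RInt (fun s => exp (Z (tau, s) x)) 0 t =
               exp (Z (tau, t) x) * RInt (fun s => exp (Z (t, s) y)) 0 t).
  { rewrite <- (RInt_scal (fun s => exp (Z (t, s) y)))
      by (apply ex_RInt_cts, cts_exp_time, hZ).
    apply RInt_ext. intros s _. rewrite (flow_semigroup tau t s x) by lra.
    rewrite exp_plus. reflexivity. }
  rewrite (RInt_scal (fun s => exp (Z (tau, s) x)))
    by (apply ex_RInt_cts, cts_exp_time, hZ).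
  rewrite <- (RInt_Chasles (fun s => exp (Z (tau, s) x)) 0 t (clamp T tau))
    by (apply ex_RInt_cts, cts_exp_time, hZ).
  unfold plus, scal; simpl; unfold mult; simpl.
  rewrite e3. clear e3.
  set (I := RInt _ 0 t). set (J := RInt _ t _). clearbody I J.
  assert (e4 : exp (- Z (tau, 0) x) * exp (Z (tau, t) x) = exp (- Z (t, 0) y)).
  { rewrite <- exp_plus. f_equal. rewrite (flow_semigroup tau t 0 x) by lra.
    fold y. ring. }
  set (A := exp (- Z (tau, 0) x)) in *. set (B := exp (- Z (t, 0) y)) in *.
  set (E := exp (Z (tau, t) x)) in *. clearbody A B E.
  set (gg := g0 _). set (hh := h0 _). clearbody gg hh.
  replace (y * (gg * B + hh * (B * B) * I)) with
    ((y * B) * (gg + hh * B * I)) by ring.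
  rewrite e2, <- e4. ring.
Qed.

(** Duhamel's formula differentiated at [tau = t]. The transported term is handled as for rho, and
    the integral contributes the source on the diagonal, which is rho/x because [h0] is rho0 divided
    by the square of [Y]. *)
Lemma sourced_equation t x l : 0 < t < T ->
  is_derive (fun y => y * gE Z t y) x l ->
  is_derive (fun tau => x * gE Z tau x) t
    (- (x * vE Z t x) * l +
     x * h0 (Yof Z (t, 0) x) * (exp (- Z (t, 0) x) * exp (- Z (t, 0) x))).
Proof.
  intros ht hl.
  set (f := fun tau s => x * h0 (Yof Z (tau, 0) x) *
                     (exp (- Z (tau, 0) x) * exp (- Z (tau, 0) x)) *
                     exp (Z (tau, s) x)).
  assert (hf : jcont f).
  { assert (hc := CC_jcont _ _ (good_CC _ hZ)).
    assert (hc0 : cts (fun z : R * R => Z (fst z, 0) x)).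
    { apply (cts_comp _ (fun z : R * R => ((fst z, 0), x)) hc).
      repeat apply cts_pair; auto using cts_const, cts_fst. }
    assert (hcs : cts (fun z : R * R => Z (fst z, snd z) x)).
    { apply (cts_comp _ (fun z : R * R => ((fst z, snd z), x)) hc).
      repeat apply cts_pair; auto using cts_const, cts_fst, cts_snd. }
    unfold f, jcont.
    repeat apply cts_mult; auto using cts_const; try (apply cts_exp; auto using cts_opp).
    apply (cts_comp h0 (fun z : R * R => Yof Z (fst z, 0) x)).
    - apply (jcont_at 0 _ h0c 0).
    - apply cts_mult; auto using cts_const. apply cts_exp; auto using cts_opp. }
  apply is_derive_ext_loc with (fun tau =>
    Yof Z (tau, t) x * gE Z t (Yof Z (tau, t) x) + RInt (f tau) t tau).
  { generalize (locally_clamp_id t ht). apply filter_imp. intros tau e.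
    rewrite (gE_semigroup t tau x ht), e. reflexivity. }
  apply @is_derive_plus.
  - apply (is_derive_comp (fun y => y * gE Z t y) (fun tau => Yof Z (tau, t) x)).
    + rewrite Yof_diag by reflexivity. exact hl.
    + apply Yof_start_derivative; auto.
  - replace (x * h0 _ * _) with (f t t).
    + apply is_derive_RInt_diag, hf.
    + unfold f. rewrite (flow_diag t t x) by reflexivity. rewrite exp_0. ring.
Qed.

(** Positive lower endpoints allow [y] to cancel, and the cut-offs at 1 drop out because [gE]
    vanishes beyond 1. *)
Lemma velocity_gE t x : 0 < beta2 <= 1 -> 1 <= beta1 -> 0 < x < 1 ->
  velocity beta1 beta2 (fun y => y * gE Z t y) x = x * vE Z t x.
Proof.
  intros hb2 hb1 hx. unfold velocity.
  assert (hm : 0 < Rmin (beta1 * x) 1 <= 1).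
  { unfold Rmin; destruct (Rle_dec _ _); nra. }
  assert (hm2 : 0 < Rmin (beta2 * x) 1 <= 1).
  { unfold Rmin; destruct (Rle_dec _ _); nra. }
  assert (hc := cts_gE Z t hZ).
  assert (he : forall u w, 0 < u -> 0 < w ->
    RInt (fun y => y * gE Z t y / y) u w = RInt (gE Z t) u w).
  { intros u w hu hw. apply RInt_ext. intros y hy.
    change (y * gE Z t y / y = gE Z t y). field.
    assert (0 < Rmin u w) by (apply Rmin_glb_lt; auto). lra. }
  rewrite !he by lra.
  assert (h1 : forall c, RInt (gE Z t) (Rmin c 1) 1 = WE Z t c).
  { intros c. unfold WE, Rmin. destruct (Rle_dec c 1); auto.
    rewrite (RInt_ext (gE Z t) (fun _ => 0) c 1).
    - rewrite RInt_point, RInt_const. exact (eq_sym (Rmult_0_r _)).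
    - intros y hy. apply gE_zero_01; auto. right.
      rewrite Rmin_right in hy by lra. lra. }
  assert (h2 := RInt_Chasles (gE Z t) (Rmin (beta2 * x) 1) (Rmin (beta1 * x) 1) 1
     (ex_RInt_cts _ _ _ hc) (ex_RInt_cts _ _ _ hc)).
  rewrite !h1 in *. unfold plus in h2; simpl in h2. unfold vE.
  rewrite <- h2. ring.
Qed.

End Flow.

(** * The space K^n *)

Lemma class_C_CC {P : UniformSpace} n f :
  class_C n f -> CC n (fun _ : P => f).
Proof.
  intros h.
  assert (hj : forall k j, (j + k <= n)%nat -> CC k (fun _ : P => Derive_n f j)).
  { induction k as [|k IH]; intros j hjk.
    - apply jcont_CC0. apply (cts_comp (Derive_n f j) (fun q : P * R => snd q));
      auto using cts_snd. intros x. apply h; lia.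
    - apply CC_intro with (fun _ => Derive_n f (S j)).
      + apply (cts_comp (Derive_n f j) (fun q : P * R => snd q));
        auto using cts_snd. intros x. apply h; lia.
      + intros _ x. apply (Derive_correct (Derive_n f j)).
        assert (hx := proj1 (h (S j) x ltac:(lia))). exact hx.
      + apply IH; lia. }
  apply (hj n 0%nat). lia.
Qed.

Lemma CC_Derive_n {P : UniformSpace} j m (f : P -> R -> R) :
  CC (j + m) f -> CC m (fun p => Derive_n (f p) j).
Proof.
  revert m; induction j as [|j IH]; intros m h; auto.
  replace (S j + m)%nat with (j + S m)%nat in h by lia.
  destruct (IH _ h) as [_ [g [hg1 hg2]]].
  replace (fun p => Derive_n (f p) (S j)) with g; auto.
  apply functional_extensionality; intros p.
  apply functional_extensionality; intros x. symmetry.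
  apply (is_derive_unique (Derive_n (f p) j)), hg1.
Qed.

Lemma CC_class_C {P : UniformSpace} n (f : P -> R -> R) p :
  CC n f -> class_C n (f p).
Proof.
  intros h k x hk. split.
  - destruct k as [|k]; [exact I|].
    assert (h' : CC (k + 1) f) by (apply CC_le with n; auto; lia).
    destruct (CC_Derive_n k 1 f h') as [_ [g [hg _]]]. exists (g p x). apply hg.
  - assert (h' : CC (k + 0) f) by (apply CC_le with n; auto; lia).
    apply (jcont_at 0 _ (CC_Derive_n k 0 f h')).
Qed.

Lemma class_C_ex_derive n f x : (1 <= n)%nat -> class_C n f -> ex_derive f x.
Proof. intros hn h. exact (proj1 (h 1%nat x hn)). Qed.

Lemma class_C_cts n f : class_C n f -> cts f.
Proof. intros h x. exact (proj2 (h 0%nat x (Nat.le_0_l n))). Qed.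

(** Left of [a], in particular near 0, the quotient is identically 0, whatever value the division
    takes at 0. *)
Lemma cts_div_id (f : R -> R) (a : R) :
  0 < a -> cts f -> (forall x, x < a -> f x = 0) -> cts (fun x => f x / x).
Proof.
  intros ha hf hz x. destruct (Rlt_dec x a) as [hx|hx].
  - apply continuous_ext_loc with (fun _ => 0); [|apply continuous_const].
    apply (locally_interval _ x m_infty a); simpl; auto.
    intros y _ hy. rewrite hz by auto. unfold Rdiv; ring.
  - apply (continuous_mult f (fun y => / y)); auto.
    apply continuity_pt_filterlim, derivable_continuous_pt.
    apply (derivable_pt_inv id); [unfold id; lra|apply derivable_pt_id].
Qed.

(** The derivative [f'/x - (f/x)/x] again consists of quotients by [x] of functions vanishing left
    of [a], so the induction closes; the second term uses the hypothesis twice. *)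
Lemma CC_div_id k (f : R -> R) (a : R) : 0 < a -> CC k (fun _ : R => f) ->
  (forall x, x < a -> f x = 0) -> CC k (fun _ : R => fun x => f x / x).
Proof.
  intros ha.
  revert f; induction k as [|k IH]; intros f hf hz.
  - apply jcont_CC0.
    apply (cts_comp (fun x => f x / x) (fun q : R * R => snd q)); auto using cts_snd.
    apply cts_div_id with a; auto. apply (jcont_at _ _ hf 0).
  - assert (hf' := CC_pred _ _ hf). assert (hc := jcont_at _ _ hf 0).
    destruct hf as [_ [f' [hd hf2]]].
    assert (hz' : forall p x, x < a -> f' p x = 0).
    { intros p x hx. rewrite <- (is_derive_unique f x _ (hd p x)).
      rewrite (Derive_ext_loc f (fun _ => 0)); [apply Derive_const|].
      apply (locally_interval _ x m_infty a); simpl; auto. }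
    apply CC_intro with (fun _ x => f' 0 x / x - (f x / x) / x).
    + apply (cts_comp (fun x => f x / x) (fun q : R * R => snd q)); auto using cts_snd.
      apply cts_div_id with a; auto.
    + intros _ x. destruct (Rlt_dec x a) as [hx|hx].
      * rewrite (hz' 0 x hx), (hz x hx).
        replace (0 / x - 0 / x / x) with 0 by (unfold Rdiv; ring).
        apply is_derive_ext_loc with (fun _ => 0); [|apply @is_derive_const].
        apply (locally_interval _ x m_infty a); simpl; auto.
        intros y _ hy. rewrite hz by auto. unfold Rdiv; ring.
      * replace (f' 0 x / x - f x / x / x) with ((f' 0 x * x - f x * 1) / x ^ 2)
          by (field; lra).
        apply (is_derive_div f (fun x => x)); [apply hd|apply @is_derive_id|lra].
    + apply CC_minus.
      * apply IH; auto.
        apply (CC_reparam k f' (fun _ => 0)); auto using cts_const.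
      * apply IH; [apply IH; auto|]. intros x hx. rewrite hz by auto.
        unfold Rdiv; ring.
Qed.

Lemma supp_included f a b : (forall x, x < a \/ b < x -> f x = 0) ->
  included (supp f) (fun x => a <= x <= b).
Proof.
  intros hz x hx. apply NNPP. intros hn.
  assert (hV : closed_set (fun x => a <= x <= b)) by apply compact_P2, compact_P3.
  destruct (hx _ (hV x hn)) as [y [hy1 hy2]].
  apply hy2, hz. unfold complementary in hy1.
  destruct (Rlt_dec y a); [auto|]. destruct (Rlt_dec b y); [auto|].
  exfalso; apply hy1; lra.
Qed.

Lemma Kn_intro n f a b : 0 < a -> b < 1 -> class_C n f ->
  (forall x, x < a \/ b < x -> f x = 0) -> Kn n f.
Proof.
  intros ha hb hf hz. assert (h := supp_included f a b hz).
  split; [auto|split].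
  - apply compact_P4 with (fun x => a <= x <= b); auto.
    + apply compact_P3.
    + apply adherence_P3.
  - intros x hx. specialize (h x hx). simpl in h. lra.
Qed.

Lemma Kn_zero n f x : Kn n f -> x <= 0 \/ 1 <= x -> f x = 0.
Proof.
  intros [_ [_ h]] hx. apply NNPP. intros hn.
  specialize (h x (adherence_P1 _ x hn)). simpl in h. lra.
Qed.

(** The points 0 and 1 lie outside the support, which is closed because it is compact, so [f]
    vanishes on a neighbourhood of each. *)
Lemma Kn_margin n f : Kn n f ->
  exists a b, 0 < a /\ 0 < b < 1 /\ forall x, x < a \/ b < x -> f x = 0.
Proof.
  intros hK. assert (hi := proj2 (proj2 hK)).
  assert (hcl := compact_P2 _ (proj1 (proj2 hK))).
  assert (hout : forall x, ~ 0 < x < 1 -> exists d : posreal,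
    forall y, Rabs (y - x) < d -> f y = 0).
  { intros x hx. destruct (hcl x (fun h => hx (hi x h))) as [d hd].
    exists d. intros y hy. apply NNPP. intros hn.
    apply (hd y hy). apply adherence_P1, hn. }
  destruct (hout 0 ltac:(lra)) as [d0 h0]. destruct (hout 1 ltac:(lra)) as [d1 h1].
  assert (q0 := cond_pos d0). assert (q1 := cond_pos d1).
  (* The maximum with 1/2 guarantees a positive [b] even when [d1] is large. *)
  exists d0, (Rmax (1 - d1 / 2) (/ 2)).
  split; auto. split.
  - split; [apply Rlt_le_trans with (/ 2); [lra|apply Rmax_r]|].
    apply Rmax_lub_lt; lra.
  - intros x hx.
    destruct (Rle_dec x 0) as [hx0|hx0]; [apply (Kn_zero n f x); auto|].
    destruct (Rle_dec 1 x) as [hx1|hx1]; [apply (Kn_zero n f x); auto|].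
    destruct hx as [hx|hx].
    + apply h0. rewrite Rminus_0_r, Rabs_pos_eq; lra.
    + apply h1. assert (q := Rmax_l (1 - d1 / 2) (/ 2)).
      apply Rabs_lt_between. lra.
Qed.

Lemma sup_norm_bounds f M : (forall x, Rabs (f x) <= M) -> 0 <= sup_norm f <= M.
Proof.
  intros h. unfold sup_norm.
  destruct (Lub_Rbar_correct (fun y => exists x, y = Rabs (f x))) as [h1 h2].
  assert (h3 := h1 (Rabs (f 0)) (ex_intro _ 0 eq_refl)).
  assert (h4 : Rbar_le (Lub_Rbar (fun y => exists x, y = Rabs (f x))) M).
  { apply h2. intros y [x ->]. apply h. }
  assert (q := Rabs_pos (f 0)).
  destruct (Lub_Rbar _) as [l| |]; simpl in *; try contradiction. lra.
Qed.

Lemma sup_norm_ge f M x : (forall x, Rabs (f x) <= M) -> Rabs (f x) <= sup_norm f.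
Proof.
  intros h. unfold sup_norm.
  destruct (Lub_Rbar_correct (fun y => exists x, y = Rabs (f x))) as [h1 h2].
  assert (h3 := h1 (Rabs (f x)) (ex_intro _ x eq_refl)).
  assert (h4 : Rbar_le (Lub_Rbar (fun y => exists x, y = Rabs (f x))) M).
  { apply h2. intros y [z ->]. apply h. }
  destruct (Lub_Rbar _) as [l| |]; simpl in *; try contradiction. lra.
Qed.

(** An infinite supremum is projected to 0 by [real], so the sign is right for unbounded [f] too. *)
Lemma sup_norm_nonneg f : 0 <= sup_norm f.
Proof.
  unfold sup_norm.
  destruct (Lub_Rbar_correct (fun y => exists x, y = Rabs (f x))) as [h1 h2].
  assert (h3 := h1 (Rabs (f 0)) (ex_intro _ 0 eq_refl)).
  assert (q := Rabs_pos (f 0)).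
  destruct (Lub_Rbar _) as [l| |]; simpl in *; lra.
Qed.

Lemma Cn_norm_bounds n f M :
  (forall j x, (j <= n)%nat -> Rabs (Derive_n f j x) <= M) ->
  0 <= Cn_norm n f <= INR (S n) * M.
Proof.
  intros h. unfold Cn_norm.
  assert (hj : forall j, (j <= n)%nat -> 0 <= sup_norm (Derive_n f j) <= M).
  { intros j hj. apply sup_norm_bounds. auto. }
  clear h. induction n as [|n IH].
  - simpl. specialize (hj 0%nat (le_n 0)). simpl in hj. lra.
  - assert (h1 := IH ltac:(intros; apply hj; lia)).
    assert (h2 := hj (S n) (le_n _)).
    rewrite tech5, S_INR. lra.
Qed.

Lemma Cn_norm_ge_term n f j : (j <= n)%nat -> sup_norm (Derive_n f j) <= Cn_norm n f.
Proof.
  unfold Cn_norm. induction n as [|n IH]; intros hj.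
  - replace j with 0%nat by lia. apply Rle_refl.
  - rewrite tech5. assert (q := sup_norm_nonneg (Derive_n f (S n))).
    destruct (Nat.eq_dec j (S n)) as [->|hn].
    + assert (h : 0 <= sum_f_R0 (fun k => sup_norm (Derive_n f k)) n).
      { apply cond_pos_sum. intros; apply sup_norm_nonneg. }
      lra.
    + specialize (IH ltac:(lia)). lra.
Qed.

Lemma Cn_norm_nonneg n f : 0 <= Cn_norm n f.
Proof.
  eapply Rle_trans; [apply (sup_norm_nonneg (Derive_n f 0))|].
  apply Cn_norm_ge_term. lia.
Qed.

Lemma Derive_n_outside f a b j x : (forall x, x < a \/ b < x -> f x = 0) ->
  x < a \/ b < x -> Derive_n f j x = 0.
Proof.
  intros hz hx. rewrite (Derive_n_ext_loc f (fun _ => 0)).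
  - destruct j; [reflexivity|apply Derive_n_const].
  - destruct hx as [hx|hx].
    + apply (locally_interval _ x m_infty a); simpl; auto.
    + apply (locally_interval _ x b p_infty); simpl; auto.
Qed.

(* Taking min(radius, 1/bound) as gauge turns a finite subcover into a uniform
   bound. *)
Lemma locally_bounded_bounded (A : R -> R -> Prop) (a b : R) :
  (forall t B B', A t B -> B <= B' -> A t B') ->
  (forall t, a <= t <= b -> exists B, locally t (fun t' => A t' B)) ->
  exists B, forall t, a <= t <= b -> A t B.
Proof.
  intros hm hl.
  assert (hd : forall t, {d : posreal | a <= t <= b ->
     forall t', Rabs (t' - t) < d -> A t' (/ d)}).
  { intros t. apply constructive_indefinite_description.
    destruct (classic (a <= t <= b)) as [ht|ht];
      [|exists (mkposreal 1 Rlt_0_1); tauto].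
    destruct (hl t ht) as [B [d hd]].
    assert (hB : 0 < / (Rabs B + 1)).
    { apply Rinv_0_lt_compat. assert (q := Rabs_pos B). lra. }
    assert (hp : 0 < Rmin d (/ (Rabs B + 1))).
    { apply Rmin_glb_lt; auto. apply cond_pos. }
    exists (mkposreal _ hp). intros _ t' ht'. apply hm with B.
    - apply hd. eapply Rlt_le_trans; [exact ht'|apply Rmin_l].
    - simpl. apply Rle_trans with (Rabs B + 1).
      + assert (q := Rle_abs B). lra.
      + rewrite <- (Rinv_inv (Rabs B + 1)) at 1.
        apply Rinv_le_contravar; auto. apply Rmin_r. }
  destruct (compactness_value_1d a b (fun th => proj1_sig (hd th))) as [d hdd].
  exists (/ d). intros t ht. apply NNPP. intros hn. apply (hdd t ht).
  intros [s [hs [h1 h2]]]. apply hn.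
  destruct (hd s) as [ds hds]; simpl in *.
  apply hm with (/ ds); [apply hds; auto|].
  apply Rinv_le_contravar; auto. apply cond_pos.
Qed.

Lemma bounded_interval f a b : cts f ->
  exists B, forall x, a <= x <= b -> Rabs (f x) <= B.
Proof.
  intros hf. apply (locally_bounded_bounded (fun x B => Rabs (f x) <= B)).
  - intros; lra.
  - intros t _. exists (Rabs (f t) + 1).
    generalize (proj1 (filterlim_locally _ _) (hf t) (mkposreal 1 Rlt_0_1)).
    apply filter_imp. intros y hy. change (Rabs (f y - f t) < 1) in hy.
    replace (f y) with ((f y - f t) + f t) by ring.
    eapply Rle_trans; [apply Rabs_triang|]. lra.
Qed.

Lemma bounded_rectangle (f : R -> R -> R) a b c d : jcont f ->
  exists B, forall t x, a <= t <= b -> c <= x <= d -> Rabs (f t x) <= B.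
Proof.
  intros hf.
  destruct (locally_bounded_bounded
    (fun t B => forall x, c <= x <= d -> Rabs (f t x) <= B) a b) as [B hB].
  - intros t B B' h hB x hx. specialize (h x hx). lra.
  - intros t _.
    destruct (bounded_interval (f t) c d (jcont_at 0 f (jcont_CC0 f hf) t)) as [B hB].
    exists (B + 1).
    generalize (tube (fun x t => f t x) c d t
      (fun x _ => cts_comp _ (fun z : R * R => (snd z, fst z)) hf
                    (cts_pair _ _ cts_snd cts_fst) (x, t)) 1 Rlt_0_1).
    apply filter_imp. intros t' h x hx. specialize (h x hx). specialize (hB x hx).
    replace (f t' x) with ((f t' x - f t x) + f t x) by ring.
    eapply Rle_trans; [apply Rabs_triang|]. lra.
  - exists B. auto.
Qed.

Lemma uniform_in_index (A : nat -> R -> Prop) n :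
  (forall j B B', A j B -> B <= B' -> A j B') ->
  (forall j, (j <= n)%nat -> exists B, A j B) ->
  exists B, forall j, (j <= n)%nat -> A j B.
Proof.
  intros hm h. induction n as [|n IH].
  - destruct (h 0%nat (le_n 0)) as [B hB]. exists B. intros j hj.
    replace j with 0%nat by lia. auto.
  - destruct (IH ltac:(intros; apply h; lia)) as [B1 h1].
    destruct (h (S n) (le_n _)) as [B2 h2]. exists (Rmax B1 B2). intros j hj.
    destruct (Nat.eq_dec j (S n)) as [->|hn].
    + apply hm with B2; auto using Rmax_r.
    + apply hm with B1; auto using Rmax_l. apply h1; lia.
Qed.

Lemma filter_forall_le {T} (F : (T -> Prop) -> Prop) {FF : Filter F}
  (A : nat -> T -> Prop) n :
  (forall j, (j <= n)%nat -> F (A j)) -> F (fun t => forall j, (j <= n)%nat -> A j t).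
Proof.
  intros h. induction n as [|n IH].
  - generalize (h 0%nat (le_n 0)). apply filter_imp. intros t ht j hj.
    replace j with 0%nat by lia. auto.
  - generalize (filter_and _ _ (h (S n) (le_n _)) (IH ltac:(intros; apply h; lia))).
    apply filter_imp. intros t [h1 h2] j hj.
    destruct (Nat.eq_dec j (S n)) as [->|hn]; auto. apply h2; lia.
Qed.

Lemma Kn_size_le n f a M : 0 < a -> (forall x, x < a -> f x = 0) ->
  Cn_norm n f <= M -> Kn_size n f <= M + / a.
Proof.
  intros ha hz hM. unfold Kn_size. apply Rplus_le_compat; auto.
  destruct (Glb_Rbar_correct (supp f)) as [h1 h2].
  assert (h3 : Rbar_le a (Glb_Rbar (supp f))).
  { apply h2. intros x hx. simpl. apply Rnot_lt_le. intros hlt.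
    assert (hd : 0 < a - x) by lra.
    destruct (hx (fun y => y < a)) as [y [hy1 hy2]].
    - exists (mkposreal _ hd). intros y hy. unfold disc in hy. simpl in hy.
      apply Rabs_lt_between in hy. lra.
    - apply hy2, hz, hy1. }
  assert (q : 0 < / a) by (apply Rinv_0_lt_compat; auto).
  (* For an empty support the infimum is [p_infty] and its inverse is 0, which is below [/ a]. *)
  destruct (Glb_Rbar (supp f)) as [l| |]; simpl in *; try lra.
  apply Rinv_le_contravar; auto.
Qed.

(** A support interval common to all times reduces every supremum over the line to [0,1], where
    joint continuity of the derivatives gives uniform continuity in [t] by the tube lemma and bounds
    by compactness. *)
Lemma C_Kn_intro n T (f : R -> R -> R) a b :
  0 < a -> b < 1 -> CC n f -> (forall t x, x < a \/ b < x -> f t x = 0) ->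
  C_Kn n T f.
Proof.
  intros ha hb hf hz.
  assert (hcl : forall t, class_C n (f t)) by (intros t; apply CC_class_C, hf).
  assert (hj : forall j, (j <= n)%nat -> jcont (fun t => Derive_n (f t) j)).
  { intros j hj. apply (CC_jcont 0), CC_Derive_n. apply CC_le with n; auto. lia. }
  split; [|split].
  - intros t _. apply Kn_intro with a b; auto.
  - intros t0 _. apply filterlim_locally. intros eps.
    assert (hn : 0 < INR (S n)) by apply lt_0_INR, Nat.lt_0_succ.
    (* The C^n norm has [S n] terms; the extra 2 makes the final inequality strict. *)
    assert (he : 0 < eps / (2 * INR (S n))).
    { apply Rdiv_lt_0_compat; [apply cond_pos|lra]. }
    assert (hloc : locally t0 (fun t => forall j, (j <= n)%nat ->
       forall x, 0 <= x <= 1 -> Rabs (Derive_n (f t) j x - Derive_n (f t0) j x)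
                   < eps / (2 * INR (S n)))).
    { apply (filter_forall_le (locally t0)). intros j hjn.
      apply (tube (fun x t => Derive_n (f t) j x)); auto.
      intros x _. exact (cts_comp _ (fun z : R * R => (snd z, fst z)) (hj j hjn)
                    (cts_pair _ _ cts_snd cts_fst) (x, t0)). }
    unfold within. generalize hloc. apply filter_imp. intros t ht _.
    assert (hd : forall j x, (j <= n)%nat ->
      Rabs (Derive_n (fun x => f t x - f t0 x) j x) <= eps / (2 * INR (S n))).
    { intros j x hjn. rewrite Derive_n_minus.
      2, 3: apply filter_forall; intros y k hk; apply hcl; lia.
      destruct (classic (0 <= x <= 1)) as [hx|hx]; [left; auto|].
      assert (hx' : x < a \/ b < x).
      { destruct (Rlt_dec x a); auto. right. lra. }
      rewrite !(Derive_n_outside _ a b j x) by auto.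
      rewrite Rminus_0_r, Rabs_R0. lra. }
    change (Rabs (Cn_norm n (fun x => f t x - f t0 x) - 0) < eps).
    destruct (Cn_norm_bounds n _ _ hd) as [q1 q2].
    rewrite Rminus_0_r, Rabs_pos_eq by auto. eapply Rle_lt_trans; [exact q2|].
    assert (q := cond_pos eps).
    replace (INR (S n) * (eps / (2 * INR (S n)))) with (eps / 2) by (field; lra). lra.
  - destruct (uniform_in_index
      (fun j B => forall t x, 0 <= t <= T -> Rabs (Derive_n (f t) j x) <= B) n)
      as [B hB].
    + intros j B B' h hBB t x ht. specialize (h t x ht). lra.
    + intros j hjn.
      destruct (bounded_rectangle _ 0 T 0 1 (hj j hjn)) as [B hB].
      exists (Rmax B 0). intros t x ht.
      destruct (classic (0 <= x <= 1)) as [hx|hx].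
      * eapply Rle_trans; [apply hB; auto|apply Rmax_l].
      * assert (hx' : x < a \/ b < x).
        { destruct (Rlt_dec x a); auto. right. lra. }
        rewrite (Derive_n_outside _ a b j x) by auto. rewrite Rabs_R0. apply Rmax_r.
    + exists (INR (S n) * B + / a). intros t ht. apply Kn_size_le; auto.
      apply Cn_norm_bounds. intros j x hjn. apply hB; auto.
Qed.

Lemma Derive_n_bounded n f j : Kn n f -> (j <= n)%nat ->
  exists B, forall x, Rabs (Derive_n f j x) <= B.
Proof.
  intros hK hj. destruct (Kn_margin n f hK) as [a [b [ha [hb hz]]]].
  destruct (bounded_interval (Derive_n f j) 0 1) as [B hB].
  { intros x. apply hK; auto. }
  exists (Rmax B 0). intros x. destruct (classic (0 <= x <= 1)) as [hx|hx].
  - eapply Rle_trans; [apply hB; auto|apply Rmax_l].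
  - rewrite (Derive_n_outside f a b j x); auto.
    + rewrite Rabs_R0. apply Rmax_r.
    + destruct (Rlt_dec x a); auto. right. lra.
Qed.

Lemma Kn_Derive_n_le_size n f j x : Kn n f -> (j <= n)%nat ->
  Rabs (Derive_n f j x) <= Kn_size n f.
Proof.
  intros hK hj. destruct (Derive_n_bounded n f j hK hj) as [B hB].
  eapply Rle_trans; [apply (sup_norm_ge _ B); auto|].
  eapply Rle_trans; [apply (Cn_norm_ge_term n); auto|].
  unfold Kn_size.
  assert (q : 0 <= Rbar_inv (Glb_Rbar (supp f))); [|lra].
  assert (h : Rbar_le 0 (Glb_Rbar (supp f))).
  { apply Glb_Rbar_correct. intros y hy. apply hK in hy. simpl in *. lra. }
  destruct (Glb_Rbar (supp f)) as [l| |]; simpl in *; try lra.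
  destruct (Rle_lt_or_eq_dec 0 l h) as [hl| <-].
  - left; apply Rinv_0_lt_compat; auto.
  - rewrite Rinv_0. lra.
Qed.

(** Reads the second summand of the size backwards. A size bound uniform in time thus gives a left
    margin uniform in time, which controls the divisions by [x] in the uniqueness proof. *)
Lemma Kn_size_left_margin n f M x : Kn n f -> Kn_size n f <= M -> 0 < M ->
  x < / M -> f x = 0.
Proof.
  intros hK hM hM0 hx. apply NNPP. intros hn.
  assert (hxs : supp f x) by apply adherence_P1, hn.
  destruct (Kn_margin n f hK) as [a [b [ha [hb hz]]]].
  destruct (Glb_Rbar_correct (supp f)) as [h1 h2].
  assert (h3 : Rbar_le a (Glb_Rbar (supp f))).
  { apply h2. intros y hy. apply (supp_included f a b hz) in hy. apply hy. }
  assert (h4 := h1 x hxs). unfold Kn_size in hM.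
  assert (q := Cn_norm_nonneg n f).
  destruct (Glb_Rbar (supp f)) as [l| |]; simpl in *; try lra.
  assert (hl : / M <= l); [|lra].
  rewrite <- (Rinv_inv l). apply Rinv_le_contravar; [|lra].
  apply Rinv_0_lt_compat. lra.
Qed.

(** * Uniqueness *)

(** Maximum taken in two stages. The chosen maximiser [X t] need not be continuous, but the maximal
    value [F t (X t)] is, by the tube lemma, so it attains its maximum in turn. *)
Lemma rectangle_maximum (F : R -> R -> R) a b c d :
  jcont F -> a <= b -> c <= d ->
  exists t x, a <= t <= b /\ c <= x <= d /\
    forall s y, a <= s <= b -> c <= y <= d -> F s y <= F t x.
Proof.
  intros hF hab hcd.
  assert (hx : forall t, {x : R | c <= x <= d /\ forall y, c <= y <= d -> F t y <= F t x}).
  { intros t. apply constructive_indefinite_description.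
    destruct (continuity_ab_maj (F t) c d hcd) as [x [h1 h2]].
    - intros y _. apply continuity_pt_filterlim, (jcont_at 0 F (jcont_CC0 F hF)).
    - exists x; auto. }
  set (X := fun t => proj1_sig (hx t)).
  assert (hX : forall t, c <= X t <= d /\ forall y, c <= y <= d -> F t y <= F t (X t)).
  { intros t. unfold X. destruct (hx t); auto. }
  clearbody X. clear hx.
  destruct (continuity_ab_maj (fun t => F t (X t)) a b hab) as [t [h1 h2]].
  - intros t _. apply continuity_pt_filterlim, filterlim_locally. intros eps.
    generalize (tube (fun x t => F t x) c d t
      (fun x _ => cts_comp _ (fun z : R * R => (snd z, fst z)) hF
                    (cts_pair _ _ cts_snd cts_fst) (x, t)) eps (cond_pos eps)).
    apply filter_imp. intros s hs.
    change (Rabs (F s (X s) - F t (X t)) < eps).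
    destruct (hX s) as [p1 p2], (hX t) as [p3 p4].
    assert (e1 := hs _ p1). assert (e2 := hs _ p3).
    assert (e3 := p2 _ p3). assert (e4 := p4 _ p1).
    apply Rabs_lt_between in e1, e2. apply Rabs_lt_between. lra.
  - exists t, (X t). destruct (hX t) as [p1 p2]. repeat split; try tauto; try lra.
    intros s y hs hy. eapply Rle_trans; [apply hX; auto|]. apply h1; auto.
Qed.

Lemma negative_derivative_left (g : R -> R) t l : is_derive g t l -> l < 0 -> 0 < t ->
  exists s, 0 < s < t /\ g t < g s.
Proof.
  intros hd hl ht. apply is_derive_Reals in hd.
  destruct (hd (- l / 2) ltac:(lra)) as [d hdd]. assert (q := cond_pos d).
  set (h := - Rmin (d / 2) (t / 2)).
  assert (h1 : 0 < Rmin (d / 2) (t / 2)) by (apply Rmin_glb_lt; lra).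
  assert (h2 := Rmin_l (d / 2) (t / 2)). assert (h3 := Rmin_r (d / 2) (t / 2)).
  assert (hh : h < 0) by (unfold h; lra).
  exists (t + h). split; [unfold h; lra|].
  assert (e := hdd h ltac:(lra)).
  rewrite Rabs_left in e by auto. specialize (e ltac:(unfold h; lra)).
  apply Rabs_lt_between in e.
  assert (e2 : (g (t + h) - g t) / h < 0) by lra.
  assert (e3 : g (t + h) - g t = (g (t + h) - g t) / h * h) by (field; lra).
  nra.
Qed.

(** The weight [exp (- ((C + 1) * t))] beats the growth rate [C] strictly: at a positive maximum of
    the weighted function its time derivative is negative, so a slightly earlier time has a larger
    value. Looking only backwards also covers a maximum on the top edge [t1], where the equation
    holds since [t1 < T]. *)
Lemma maximum_principle (F : R -> R -> R) (T C : R) :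
  jcont F ->
  (forall x, F 0 x <= 0) -> (forall t x, x <= 0 \/ 1 <= x -> F t x <= 0) ->
  (forall t x, 0 < t < T -> 0 < x < 1 -> (forall y, F t y <= F t x) ->
     exists l, is_derive (fun s => F s x) t l /\ l <= C * F t x) ->
  forall t x, 0 <= t < T -> F t x <= 0.
Proof.
  intros hF h0 hb hd t1 x1 ht1. apply Rnot_lt_le. intros hpos.
  set (G := fun t x => exp (- ((C + 1) * t)) * F t x).
  assert (hG : jcont G).
  { apply cts_mult; auto. apply cts_exp, cts_opp, cts_mult; auto using cts_const, cts_fst. }
  destruct (rectangle_maximum G 0 t1 0 1 hG) as [t [x [ht [hx hmax]]]]; try lra.
  assert (hx1 : 0 < x1 < 1).
  { split; apply Rnot_le_lt; intros h; assert (q := hb t1 x1); lra. }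
  assert (hGp : 0 < G t x).
  { apply Rlt_le_trans with (G t1 x1); [|apply hmax; lra].
    apply Rmult_lt_0_compat; auto. apply exp_pos. }
  assert (hFp : 0 < F t x).
  { apply Rnot_le_lt. intros h. unfold G in hGp.
    assert (q := exp_pos (- ((C + 1) * t))). nra. }
  assert (ht0 : 0 < t).
  { destruct (Req_dec t 0) as [->|]; [|lra]. assert (q := h0 x). lra. }
  assert (hx0 : 0 < x < 1).
  { split; apply Rnot_le_lt; intros h; assert (q := hb t x); lra. }
  assert (hsp : forall y, F t y <= F t x).
  { intros y. destruct (Rle_dec y 0) as [h|h]; [assert (q := hb t y); lra|].
    destruct (Rle_dec 1 y) as [h'|h']; [assert (q := hb t y); lra|].
    assert (e := hmax t y ltac:(lra) ltac:(lra)). unfold G in e.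
    apply Rmult_le_reg_l in e; auto. apply exp_pos. }
  destruct (hd t x ltac:(lra) hx0 hsp) as [l [hl1 hl2]].
  destruct (negative_derivative_left (fun s => G s x) t
    (- (C + 1) * exp (- ((C + 1) * t)) * F t x + exp (- ((C + 1) * t)) * l)) as [s [hs1 hs2]].
  - apply (is_derive_mult (fun s => exp (- ((C + 1) * s))) (fun s => F s x)); auto.
    + auto_derive; auto. ring.
    + intros; apply Rmult_comm.
  - assert (q := exp_pos (- ((C + 1) * t))). nra.
  - auto.
  - assert (e := hmax s x ltac:(lra) ltac:(lra)). lra.
Qed.

(** The zeroth term of the C^n norm controls the change of profile uniformly in [x], and continuity
    of the single profile at [t0] does the rest. Composing with the clamp converts continuity within
    [0,T] into continuity at every real time. *)
Lemma C_Kn_jcont n T f : 0 <= T -> C_Kn n T f -> jcont (fun t => f (clamp T t)).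
Proof.
  intros hT [hK [hc _]] [t0 x0]. apply filterlim_locally. intros eps.
  assert (he : 0 < eps / 2) by (assert (q := cond_pos eps); lra).
  assert (ht0 := clamp_in T t0 hT).
  assert (h1 := proj1 (filterlim_locally _ _) (hc _ ht0) (mkposreal _ he)).
  unfold within in h1. apply (cts_clamp T t0) in h1. destruct h1 as [d1 h1].
  assert (h2 := proj1 (filterlim_locally _ _)
    (class_C_cts n _ (proj1 (hK _ ht0)) x0) (mkposreal _ he)).
  destruct h2 as [d2 h2].
  assert (hd : 0 < Rmin d1 d2) by (apply Rmin_glb_lt; apply cond_pos).
  exists (mkposreal _ hd). intros [t x] [ht hx]. simpl in ht, hx.
  specialize (h1 t (ball_le t0 (mkposreal _ hd) d1 (Rmin_l d1 d2) _ ht)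
                (clamp_in T t hT)).
  specialize (h2 x (ball_le x0 (mkposreal _ hd) d2 (Rmin_r d1 d2) _ hx)).
  change (Rabs (Cn_norm n (fun x => f (clamp T t) x - f (clamp T t0) x) - 0) < eps / 2) in h1.
  change (Rabs (f (clamp T t0) x - f (clamp T t0) x0) < eps / 2) in h2.
  change (Rabs (f (clamp T t) x - f (clamp T t0) x0) < eps).
  rewrite Rminus_0_r, Rabs_pos_eq in h1 by apply Cn_norm_nonneg.
  assert (h3 : Rabs (f (clamp T t) x - f (clamp T t0) x) < eps / 2).
  { eapply Rle_lt_trans; [|exact h1].
    eapply Rle_trans; [|apply (Cn_norm_ge_term n _ 0); lia].
    destruct (Derive_n_bounded n _ 0 (hK _ (clamp_in T t hT)) (Nat.le_0_l n)) as [B1 hB1].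
    destruct (Derive_n_bounded n _ 0 (hK _ ht0) (Nat.le_0_l n)) as [B2 hB2].
    apply (sup_norm_ge (fun x => f (clamp T t) x - f (clamp T t0) x) (B1 + B2)).
    intros y. specialize (hB1 y). specialize (hB2 y). simpl in hB1, hB2.
    unfold Rminus. eapply Rle_trans; [apply Rabs_triang|]. rewrite Rabs_Ropp. lra. }
  replace (f (clamp T t) x - f (clamp T t0) x0) with
    ((f (clamp T t) x - f (clamp T t0) x) + (f (clamp T t0) x - f (clamp T t0) x0)) by ring.
  eapply Rle_lt_trans; [apply Rabs_triang|]. lra.
Qed.

(** Below [m] both profiles vanish, above it dividing by [y] costs at most [/ m], and the intervals
    lie in [0,1]. The 2 counts the two integrals. *)
Lemma velocity_diff beta1 beta2 f1 f2 m q x :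
  0 < beta2 -> 1 <= beta1 -> 0 < m -> cts f1 -> cts f2 ->
  (forall y, y < m -> f1 y = 0) -> (forall y, y < m -> f2 y = 0) ->
  (forall y, Rabs (f1 y - f2 y) <= q) -> 0 < x < 1 ->
  Rabs (velocity beta1 beta2 f1 x - velocity beta1 beta2 f2 x) <= 2 * (q / m).
Proof.
  intros hb2 hb1 hm c1 c2 z1 z2 hq hx.
  assert (d1 := cts_div_id f1 m hm c1 z1). assert (d2 := cts_div_id f2 m hm c2 z2).
  assert (hq0 : 0 <= q) by (eapply Rle_trans; [apply Rabs_pos|apply (hq 0)]).
  assert (hqm : 0 <= q / m) by (apply Rdiv_le_0_compat; auto).
  assert (hI : forall u v, 0 <= u <= 1 -> 0 <= v <= 1 ->
    Rabs (RInt (fun y => f1 y / y) u v - RInt (fun y => f2 y / y) u v) <= q / m).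
  { intros u v hu hv.
    replace (RInt (fun y => f1 y / y) u v - RInt (fun y => f2 y / y) u v)
      with (RInt (fun y => f1 y / y - f2 y / y) u v)
      by (apply (RInt_minus (fun y => f1 y / y) (fun y => f2 y / y));
          apply ex_RInt_cts; auto).
    eapply Rle_trans.
    - apply (abs_RInt_le _ _ _ (q / m)); [apply cts_minus; auto|].
      intros y. destruct (Rlt_dec y m) as [hy|hy].
      + rewrite z1, z2, Rminus_diag, Rabs_R0 by auto. auto.
      + replace (f1 y / y - f2 y / y) with ((f1 y - f2 y) * / y) by (field; lra).
        rewrite Rabs_mult, (Rabs_pos_eq (/ y)) by (left; apply Rinv_0_lt_compat; lra).
        apply Rmult_le_compat; auto using Rabs_pos.
        * left; apply Rinv_0_lt_compat; lra.
        * apply Rinv_le_contravar; lra.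
    - rewrite <- (Rmult_1_l (q / m)) at 2. apply Rmult_le_compat_r; auto.
      apply Rabs_le_between; lra. }
  assert (r1 : 0 <= Rmin (beta1 * x) 1 <= 1).
  { unfold Rmin; destruct (Rle_dec _ _); nra. }
  assert (r2 : 0 <= Rmin (beta2 * x) 1 <= 1).
  { unfold Rmin; destruct (Rle_dec _ _); nra. }
  assert (i1 := hI _ _ r2 r1). assert (i2 := hI _ 1 r1 ltac:(lra)).
  unfold velocity.
  set (p1 := RInt _ _ _) in *. set (p2 := RInt (fun y => f2 y / y) (Rmin (beta2 * x) 1) _) in *.
  set (p3 := RInt (fun y => f1 y / y) (Rmin (beta1 * x) 1) _) in *.
  set (p4 := RInt (fun y => f2 y / y) (Rmin (beta1 * x) 1) _) in *.
  clearbody p1 p2 p3 p4.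
  replace (x * p1 - x * p3 - (x * p2 - x * p4)) with
    (x * ((p1 - p2) - (p3 - p4))) by ring.
  rewrite Rabs_mult, (Rabs_pos_eq x) by lra.
  assert (e : Rabs (p1 - p2 - (p3 - p4)) <= 2 * (q / m)).
  { unfold Rminus at 1. eapply Rle_trans; [apply Rabs_triang|].
    rewrite Rabs_Ropp. lra. }
  assert (e' := Rabs_pos (p1 - p2 - (p3 - p4))). nra.
Qed.

Lemma derivative_at_maximum (f : R -> R) x l :
  is_derive f x l -> (forall y, f y <= f x) -> l = 0.
Proof.
  intros hd hm. apply is_derive_Reals in hd.
  assert (h := deriv_maximum f (x - 1) (x + 1) x (exist _ l hd) ltac:(lra) ltac:(lra)
                 (fun y _ _ => hm y)).
  exact h.
Qed.

(* Where the squared distance F of the solutions is maximal in x, dF/dx = 0 removes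
   the transport term, and the nonlocal velocity difference is controlled by the
   value of F at that same point. *)
Lemma solution_energy_zero n beta1 beta2 T w0 r0 w1 r1 w2 r2 :
  (1 <= n)%nat -> 0 < T -> 0 < beta2 -> 1 <= beta1 ->
  is_solution n beta1 beta2 T w0 r0 w1 r1 ->
  is_solution n beta1 beta2 T w0 r0 w2 r2 ->
  forall t x, 0 <= t < T ->
    (w1 (clamp T t) x - w2 (clamp T t) x) ^ 2 +
    (r1 (clamp T t) x - r2 (clamp T t) x) ^ 2 <= 0.
Proof.
  intros hn hT hb2 hb1 [cw1 [cr1 [s1 i1]]] [cw2 [cr2 [s2 i2]]].
  assert (jw1 := C_Kn_jcont n T w1 ltac:(lra) cw1).
  assert (jw2 := C_Kn_jcont n T w2 ltac:(lra) cw2).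
  assert (jr1 := C_Kn_jcont n T r1 ltac:(lra) cr1).
  assert (jr2 := C_Kn_jcont n T r2 ltac:(lra) cr2).
  assert (hM : exists M, 0 < M /\ forall t, 0 <= t <= T ->
    Kn_size n (w1 t) <= M /\ Kn_size n (w2 t) <= M /\
    Kn_size n (r1 t) <= M /\ Kn_size n (r2 t) <= M).
  { destruct cw1 as [_ [_ [M1 h1]]], cw2 as [_ [_ [M2 h2]]],
      cr1 as [_ [_ [M3 h3]]], cr2 as [_ [_ [M4 h4]]].
    exists (Rabs M1 + Rabs M2 + Rabs M3 + Rabs M4 + 1).
    assert (p1 := Rabs_pos M1). assert (p2 := Rabs_pos M2).
    assert (p3 := Rabs_pos M3). assert (p4 := Rabs_pos M4).
    assert (q1 := Rle_abs M1). assert (q2 := Rle_abs M2).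
    assert (q3 := Rle_abs M3). assert (q4 := Rle_abs M4).
    split; [lra|]. intros t ht.
    specialize (h1 t ht); specialize (h2 t ht); specialize (h3 t ht); specialize (h4 t ht).
    repeat split; lra. }
  destruct hM as [M [hM0 hM]].
  destruct cw1 as [kw1 _], cw2 as [kw2 _], cr1 as [kr1 _], cr2 as [kr2 _].
  (* In the growth rate, [2 * M] comes from the source rho/x and [8 * M ^ 2] from the velocity
     difference, at most [2 * q * M], multiplied by gradients bounded by [M]. *)
  apply (maximum_principle (fun t x => (w1 (clamp T t) x - w2 (clamp T t) x) ^ 2 +
    (r1 (clamp T t) x - r2 (clamp T t) x) ^ 2) T (2 * M + 8 * M ^ 2)).
  - assert (hsq : forall f g : R -> R -> R, jcont f -> jcont g ->
      jcont (fun t x => (f t x - g t x) ^ 2)).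
    { intros f g hf hg. unfold jcont. simpl.
      repeat apply cts_mult; try apply cts_minus; auto using cts_const. }
    apply cts_plus;
      [exact (hsq _ _ jw1 jw2)|exact (hsq _ _ jr1 jr2)].
  - intros x. rewrite clamp_id by lra.
    destruct (i1 x) as [-> ->], (i2 x) as [-> ->]. lra.
  - intros t x hx. assert (ht := clamp_in T t ltac:(lra)).
    rewrite (Kn_zero n _ x (kw1 _ ht) hx), (Kn_zero n _ x (kw2 _ ht) hx),
      (Kn_zero n _ x (kr1 _ ht) hx), (Kn_zero n _ x (kr2 _ ht) hx). lra.
  - intros t x ht hx hmax. rewrite (clamp_id T t) in * by lra.
    assert (ht' : 0 <= t <= T) by lra.
    destruct (hM t ht') as [m1 [m2 [m3 m4]]].
    specialize (kw1 t ht'). specialize (kw2 t ht').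
    specialize (kr1 t ht'). specialize (kr2 t ht').
    destruct (s1 t x ht hx) as [ew1 [pw1 [er1 pr1]]].
    destruct (s2 t x ht hx) as [ew2 [pw2 [er2 pr2]]].
    assert (dtw1 : is_derive (fun s => w1 s x) t (Derive (fun s : R => w1 s x) t))
      by exact (Derive_correct _ _ ew1).
    assert (dtw2 : is_derive (fun s => w2 s x) t (Derive (fun s : R => w2 s x) t))
      by exact (Derive_correct _ _ ew2).
    assert (dtr1 : is_derive (fun s => r1 s x) t (Derive (fun s : R => r1 s x) t))
      by exact (Derive_correct _ _ er1).
    assert (dtr2 : is_derive (fun s => r2 s x) t (Derive (fun s : R => r2 s x) t))
      by exact (Derive_correct _ _ er2).
    set (w1t := Derive (fun s => w1 s x) t) in *. set (w2t := Derive (fun s => w2 s x) t) in *.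
    set (r1t := Derive (fun s => r1 s x) t) in *. set (r2t := Derive (fun s => r2 s x) t) in *.
    clearbody w1t w2t r1t r2t.
    assert (dw1 := Derive_correct _ _ (class_C_ex_derive n _ x hn (proj1 kw1))).
    assert (dw2 := Derive_correct _ _ (class_C_ex_derive n _ x hn (proj1 kw2))).
    assert (dr1 := Derive_correct _ _ (class_C_ex_derive n _ x hn (proj1 kr1))).
    assert (dr2 := Derive_correct _ _ (class_C_ex_derive n _ x hn (proj1 kr2))).
    assert (bw2 : Rabs (Derive (w2 t) x) <= M).
    { eapply Rle_trans; [|exact m2]. apply (Kn_Derive_n_le_size n _ 1); auto. }
    assert (br2 : Rabs (Derive (r2 t) x) <= M).
    { eapply Rle_trans; [|exact m4]. apply (Kn_Derive_n_le_size n _ 1); auto. }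
    set (w1x := Derive (w1 t) x) in *. set (w2x := Derive (w2 t) x) in *.
    set (r1x := Derive (r1 t) x) in *. set (r2x := Derive (r2 t) x) in *.
    clearbody w1x w2x r1x r2x.
    assert (hsq : forall (f g : R -> R) z df dg, is_derive f z df -> is_derive g z dg ->
      is_derive (fun y => (f y - g y) ^ 2) z (2 * (f z - g z) * (df - dg))).
    { intros f g z df dg hf hg.
      replace (2 * (f z - g z) * (df - dg)) with
        (INR 2 * (df - dg) * (f z - g z) ^ 1) by (simpl; ring).
      apply (is_derive_pow (fun y => f y - g y) 2).
      apply @is_derive_minus; auto. }
    assert (hFx := derivative_at_maximum _ x _
      (is_derive_plus _ _ _ _ _ (hsq _ _ _ _ _ dw1 dw2) (hsq _ _ _ _ _ dr1 dr2)) hmax).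
    change (2 * (w1 t x - w2 t x) * (w1x - w2x) + 2 * (r1 t x - r2 t x) * (r1x - r2x) = 0)
      in hFx.
    set (F := (w1 t x - w2 t x) ^ 2 + (r1 t x - r2 t x) ^ 2) in *.
    assert (hF0 : 0 <= F).
    { unfold F. assert (q1 := pow2_ge_0 (w1 t x - w2 t x)).
      assert (q2 := pow2_ge_0 (r1 t x - r2 t x)). lra. }
    set (q := sqrt F). assert (hq0 : 0 <= q) by apply sqrt_pos.
    assert (hqq : q * q = F) by (apply sqrt_sqrt; auto).
    assert (habs : forall p s, p ^ 2 + s ^ 2 <= F -> Rabs p <= q /\ Rabs s <= q).
    { intros p s hps. rewrite <- !sqrt_Rsqr_abs.
      split; apply sqrt_le_1_alt; unfold Rsqr; nra. }
    assert (hdu := velocity_diff beta1 beta2 (w1 t) (w2 t) (/ M) q x hb2 hb1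
      (Rinv_0_lt_compat M hM0) (class_C_cts n _ (proj1 kw1)) (class_C_cts n _ (proj1 kw2))
      (fun y => Kn_size_left_margin n _ M y kw1 m1 hM0)
      (fun y => Kn_size_left_margin n _ M y kw2 m2 hM0)
      (fun y => proj1 (habs _ _ (hmax y))) hx).
    replace (q / / M) with (q * M) in hdu by (field; lra).
    destruct (habs _ _ (Rle_refl F)) as [hD hR].
    assert (hRx : Rabs ((r1 t x - r2 t x) / x) <= q * M).
    { destruct (Rlt_dec x (/ M)) as [hxm|hxm].
      - rewrite (Kn_size_left_margin n _ M x kr1 m3 hM0 hxm),
          (Kn_size_left_margin n _ M x kr2 m4 hM0 hxm).
        unfold Rdiv. rewrite Rminus_diag, Rmult_0_l, Rabs_R0. nra.
      - unfold Rdiv. rewrite Rabs_mult, (Rabs_pos_eq (/ x))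
          by (left; apply Rinv_0_lt_compat; lra).
        apply Rmult_le_compat; auto using Rabs_pos.
        + left; apply Rinv_0_lt_compat; lra.
        + rewrite <- (Rinv_inv M). apply Rinv_le_contravar; [|lra].
          apply Rinv_0_lt_compat; auto. }
    exists (2 * (w1 t x - w2 t x) * (w1t - w2t) + 2 * (r1 t x - r2 t x) * (r1t - r2t)).
    split.
    + apply is_derive_ext_loc with
        (fun s => (w1 s x - w2 s x) ^ 2 + (r1 s x - r2 s x) ^ 2).
      * generalize (locally_clamp_id T t ht). apply filter_imp. intros s ->. reflexivity.
      * apply @is_derive_plus.
        { exact (hsq _ _ t _ _ dtw1 dtw2). }
        { exact (hsq _ _ t _ _ dtr1 dtr2). }
    + simpl in pw1, pr1, pw2, pr2.
      set (u1 := velocity beta1 beta2 (w1 t) x) in *.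
      set (u2 := velocity beta1 beta2 (w2 t) x) in *.
      (* The transport difference is split so that [u1] multiplies differences of gradients, in both
         equations; these recombine into dF/dx, which is 0 here. *)
      assert (ex1 : w1t - w2t = (r1 t x - r2 t x) / x - u1 * (w1x - w2x) - (u1 - u2) * w2x).
      { unfold Rdiv in *. rewrite Rmult_minus_distr_r. lra. }
      assert (ex2 : r1t - r2t = - u1 * (r1x - r2x) - (u1 - u2) * r2x) by lra.
      rewrite ex1, ex2.
      set (D := w1 t x - w2 t x) in *. set (E := r1 t x - r2 t x) in *.
      set (du := u1 - u2) in *.
      replace (2 * D * (E / x - u1 * (w1x - w2x) - du * w2x) +
               2 * E * (- u1 * (r1x - r2x) - du * r2x)) with
        (2 * (D * (E / x)) - 2 * (du * (D * w2x + E * r2x))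
         - u1 * (2 * D * (w1x - w2x) + 2 * E * (r1x - r2x))) by ring.
      rewrite hFx, Rmult_0_r, Rminus_0_r.
      assert (t1 : Rabs (D * (E / x)) <= q * (q * M)).
      { rewrite Rabs_mult. apply Rmult_le_compat; auto using Rabs_pos. }
      assert (t2 : Rabs (du * (D * w2x + E * r2x)) <= 2 * (q * M) * (q * M + q * M)).
      { rewrite Rabs_mult. apply Rmult_le_compat; auto using Rabs_pos.
        eapply Rle_trans; [apply Rabs_triang|]. rewrite !Rabs_mult.
        apply Rplus_le_compat; apply Rmult_le_compat; auto using Rabs_pos. }
      apply Rabs_le_between in t1, t2. rewrite <- hqq. nra.
Qed.

Lemma solution_unique n beta1 beta2 T w0 r0 w1 r1 w2 r2 :
  (1 <= n)%nat -> 0 < T -> 0 < beta2 -> 1 <= beta1 ->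
  is_solution n beta1 beta2 T w0 r0 w1 r1 ->
  is_solution n beta1 beta2 T w0 r0 w2 r2 ->
  forall t x, 0 <= t <= T -> w1 t x = w2 t x /\ r1 t x = r2 t x.
Proof.
  intros hn hT hb2 hb1 h1 h2.
  assert (hE := solution_energy_zero n beta1 beta2 T w0 r0 w1 r1 w2 r2 hn hT hb2 hb1 h1 h2).
  assert (h : forall t x, 0 <= t < T ->
    w1 (clamp T t) x - w2 (clamp T t) x = 0 /\ r1 (clamp T t) x - r2 (clamp T t) x = 0).
  { intros t x ht. specialize (hE t x ht).
    assert (q1 := pow2_ge_0 (w1 (clamp T t) x - w2 (clamp T t) x)).
    assert (q2 := pow2_ge_0 (r1 (clamp T t) x - r2 (clamp T t) x)).
    split; apply Rsqr_0_uniq; unfold Rsqr; simpl in *; lra. }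
  (* The energy estimate stops short of [T]; the endpoint is reached by continuity in time. *)
  assert (hend : forall f g : R -> R -> R, C_Kn n T f -> C_Kn n T g ->
    (forall t x, 0 <= t < T -> f (clamp T t) x - g (clamp T t) x = 0) ->
    forall t x, 0 <= t <= T -> f t x = g t x).
  { intros f g hf hg hfg t x ht. apply Rminus_diag_uniq.
    destruct (Rlt_dec t T) as [htT|htT].
    { rewrite <- (clamp_id T t) by auto. apply hfg; lra. }
    assert (e : t = T) by lra. subst t.
    set (d := fun s => f (clamp T s) x - g (clamp T s) x).
    assert (hd : cts d).
    { apply cts_minus; [apply (cts_comp _ (fun s : R => (s, x)) (C_Kn_jcont n T f ltac:(lra) hf))
        |apply (cts_comp _ (fun s : R => (s, x)) (C_Kn_jcont n T g ltac:(lra) hg))];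
      apply cts_pair; auto using cts_id, cts_const. }
    assert (hdT : d T = f T x - g T x) by (unfold d; rewrite clamp_id by lra; auto).
    rewrite <- hdT. apply NNPP. intros hne.
    assert (hp : 0 < Rabs (d T)) by (apply Rabs_pos_lt; auto).
    destruct (proj1 (filterlim_locally _ _) (hd T) (mkposreal _ hp)) as [e he].
    assert (q := cond_pos e).
    assert (hm : 0 < Rmin (e / 2) (T / 2)) by (apply Rmin_glb_lt; lra).
    assert (m1 := Rmin_l (e / 2) (T / 2)). assert (m2 := Rmin_r (e / 2) (T / 2)).
    specialize (he (T - Rmin (e / 2) (T / 2))).
    assert (hb : ball T e (T - Rmin (e / 2) (T / 2))).
    { change (Rabs (T - Rmin (e / 2) (T / 2) - T) < e). apply Rabs_lt_between. lra. }
    specialize (he hb).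
    change (Rabs (d (T - Rmin (e / 2) (T / 2)) - d T) < Rabs (d T)) in he.
    unfold d at 1 in he. rewrite hfg in he by lra.
    rewrite Rminus_0_l, Rabs_Ropp in he. lra. }
  intros t x ht. split.
  - apply (hend w1 w2); auto; [apply h1|apply h2|]. intros; apply h; auto.
  - apply (hend r1 r2); auto; [apply h1|apply h2|]. intros; apply h; auto.
Qed.

(** * Existence *)

Lemma bounded_compact_support f a b : 0 < a -> b < 1 -> cts f ->
  (forall x, x < a \/ b < x -> f x = 0) -> exists B, forall x, Rabs (f x) <= B.
Proof.
  intros ha hb hf hz. destruct (bounded_interval f 0 1 hf) as [B hB].
  exists (Rmax B 0). intros x. destruct (classic (0 <= x <= 1)) as [hx|hx].
  - eapply Rle_trans; [apply hB; auto|apply Rmax_l].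
  - rewrite hz; [rewrite Rabs_R0; apply Rmax_r|].
    destruct (Rlt_dec x a); auto. right. lra.
Qed.

Lemma lipschitz_compact_support f a b : 0 < a -> b < 1 -> CC 1 (fun _ : R => f) ->
  (forall x, x < a \/ b < x -> f x = 0) ->
  exists L, forall x y, Rabs (f x - f y) <= L * Rabs (x - y).
Proof.
  intros ha hb [_ [f' [hd hf']]] hz.
  destruct (bounded_compact_support (f' 0) a b ha hb (jcont_at _ _ hf' 0)) as [L hL].
  { intros x hx. rewrite <- (is_derive_unique f x _ (hd 0 x)).
    exact (Derive_n_outside f a b 1 x hz hx). }
  exists L. intros x y.
  destruct (MVT_gen f y x (f' 0)) as [c [_ e]].
  - intros; apply hd.
  - intros z _. apply continuity_pt_filterlim, (ex_derive_continuous f).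
    exists (f' 0 z). apply hd.
  - rewrite e, Rabs_mult. apply Rmult_le_compat_r; auto using Rabs_pos.
Qed.

Lemma exists_exp_margin b : 0 < b < 1 -> exists kap, 0 < kap <= 1 /\ b * exp kap < 1.
Proof.
  intros hb. assert (hl : ln b < 0) by (rewrite <- ln_1; apply ln_increasing; lra).
  (* This makes [b * exp kap] at most the square root of [b]. *)
  exists (Rmin 1 (- ln b / 2)). split.
  - split; [apply Rmin_glb_lt; lra|apply Rmin_l].
  - apply Rlt_le_trans with (exp 0); [|rewrite exp_0; lra].
    rewrite <- (exp_ln b) at 1 by lra. rewrite <- exp_plus.
    apply exp_increasing. assert (q := Rmin_r 1 (- ln b / 2)). lra.
Qed.

Lemma exists_small_time kap A B : 0 < kap -> 0 <= A -> 0 <= B ->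
  exists T, 0 < T <= 1 /\ T * A <= kap /\ T * B <= / 2.
Proof.
  intros hk hA hB.
  assert (h1 : 0 < kap / (A + 1)) by (apply Rdiv_lt_0_compat; lra).
  assert (h2 : 0 < / 2 / (B + 1)) by (apply Rdiv_lt_0_compat; lra).
  exists (Rmin 1 (Rmin (kap / (A + 1)) (/ 2 / (B + 1)))).
  set (T := Rmin 1 _).
  assert (t0 : 0 < T) by (repeat apply Rmin_glb_lt; lra).
  assert (t1 : T <= 1) by apply Rmin_l.
  assert (t2 : T <= kap / (A + 1)).
  { eapply Rle_trans; [apply Rmin_r|apply Rmin_l]. }
  assert (t3 : T <= / 2 / (B + 1)).
  { eapply Rle_trans; [apply Rmin_r|apply Rmin_r]. }
  apply Rle_div_r in t2; [|lra]. apply Rle_div_r in t3; [|lra].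
  split; [lra|split; lra].
Qed.

Lemma solution_exists beta1 beta2 n omega0 rho0 :
  0 < beta2 <= 1 -> 1 <= beta1 -> (1 <= n)%nat -> Kn n omega0 -> Kn n rho0 ->
  exists T, 0 < T /\ exists omega rho,
    is_solution n beta1 beta2 T omega0 rho0 omega rho.
Proof.
  intros hb2 hb1 hn hw hr.
  destruct (Kn_margin n _ hw) as [aw [bw [haw [hbw hzw]]]].
  destruct (Kn_margin n _ hr) as [ar [br [har [hbr hzr]]]].
  set (a := Rmin aw ar). set (b := Rmax bw br).
  assert (ha : 0 < a) by (apply Rmin_glb_lt; auto).
  assert (hb : 0 < b < 1).
  { split; [apply Rlt_le_trans with bw; [lra|apply Rmax_l]|apply Rmax_lub_lt; lra]. }
  assert (zw : forall x, x < a \/ b < x -> omega0 x = 0).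
  { intros x hx. apply hzw. assert (q1 := Rmin_l aw ar). assert (q2 := Rmax_l bw br).
    fold a in q1. fold b in q2. lra. }
  assert (zr : forall x, x < a \/ b < x -> rho0 x = 0).
  { intros x hx. apply hzr. assert (q1 := Rmin_r aw ar). assert (q2 := Rmax_r bw br).
    fold a in q1. fold b in q2. lra. }
  clearbody a b. clear aw bw haw hbw hzw ar br har hbr hzr.
  set (g0 := fun x => omega0 x / x). set (h0 := fun x => rho0 x / x / x).
  assert (g0n : CC n (fun _ : R => g0)).
  { apply CC_div_id with a; auto. apply class_C_CC, hw. }
  assert (h0n : CC n (fun _ : R => h0)).
  { apply (CC_div_id n (fun x => rho0 x / x) a); auto.
    - apply CC_div_id with a; auto. apply class_C_CC, hr.
    - intros x hx. rewrite zr by auto. unfold Rdiv; ring. }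
  assert (g0z : forall x, x < a \/ b < x -> g0 x = 0).
  { intros x hx. unfold g0. rewrite zw by auto. unfold Rdiv; ring. }
  assert (h0z : forall x, x < a \/ b < x -> h0 x = 0).
  { intros x hx. unfold h0. rewrite zr by auto. unfold Rdiv; ring. }
  assert (g0c := CC_le 0 n _ ltac:(lia) g0n). assert (h0c := CC_le 0 n _ ltac:(lia) h0n).
  destruct (bounded_compact_support g0 a b ha (proj2 hb) (jcont_at _ _ g0c 0) g0z) as [G1 hG1].
  destruct (bounded_compact_support h0 a b ha (proj2 hb) (jcont_at _ _ h0c 0) h0z) as [G2 hG2].
  (* Here [1 <= n] supplies the Lipschitz constants that the contraction needs. *)
  destruct (lipschitz_compact_support g0 a b ha (proj2 hb) (CC_le _ _ _ hn g0n) g0z) as [L1 hL1].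
  destruct (lipschitz_compact_support h0 a b ha (proj2 hb) (CC_le _ _ _ hn h0n) h0z) as [L2 hL2].
  set (G := Rmax G1 G2). set (L := Rmax L1 L2).
  assert (g0b : forall x, Rabs (g0 x) <= G).
  { intros x. eapply Rle_trans; [apply hG1|apply Rmax_l]. }
  assert (h0b : forall x, Rabs (h0 x) <= G).
  { intros x. eapply Rle_trans; [apply hG2|apply Rmax_r]. }
  assert (g0l : forall x y, Rabs (g0 x - g0 y) <= L * Rabs (x - y)).
  { intros x y. eapply Rle_trans; [apply hL1|].
    apply Rmult_le_compat_r; [apply Rabs_pos|apply Rmax_l]. }
  assert (h0l : forall x y, Rabs (h0 x - h0 y) <= L * Rabs (x - y)).
  { intros x y. eapply Rle_trans; [apply hL2|].
    apply Rmult_le_compat_r; [apply Rabs_pos|apply Rmax_r]. }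
  assert (hG0 := G_nonneg g0 G g0b). assert (hL0 := L_nonneg g0 L g0l).
  clearbody G L. clear G1 G2 L1 L2 hG1 hG2 hL1 hL2.
  destruct (exists_exp_margin b hb) as [kap [hkap hbk]].
  (* These are [3 * K] and [3 * K + 3 * C] written out. The time is fixed before any higher
     derivative enters, and [flow_CC] gives C^n regularity without shortening it. *)
  destruct (exists_small_time kap (3 * (30 * G)) (3 * (30 * G) + 3 * (90 * L + 84 * G)))
    as [T [hT [hTk hTc]]]; try lra.
  destruct (flow_exists beta1 beta2 T g0 h0 a b kap G L hT ha (proj1 hb) hkap hbk
    g0c h0c g0b h0b g0l h0l g0z h0z hTk hTc) as [Z [hZ hfix]].
  assert (hZn := flow_CC beta1 beta2 T g0 h0 kap hT g0c h0c Z hZ hfix n g0n h0n).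
  assert (hct : cts (fun t : R => (t, 0))) by (apply cts_pair; auto using cts_id, cts_const).
  set (omega := fun t x => x * gE T g0 h0 Z t x).
  set (rho := fun t x => rho0 (Yof Z (t, 0) x)).
  assert (hom : CC n omega).
  { apply (CC_mult n (fun _ x => x)); [apply CC_id|]. apply CC_gE; auto. }
  assert (hrh : CC n rho).
  { apply (CC_comp n (fun _ : R => rho0) (fun t => Yof Z (t, 0))).
    - apply class_C_CC, hr.
    - apply (CC_reparam n (Yof Z) (fun t => (t, 0))); auto. apply CC_Yof, hZn. }
  assert (ha' : 0 < a * exp (- kap)).
  { apply Rmult_lt_0_compat; auto. apply exp_pos. }
  exists T. split; [lra|]. exists omega, rho. split; [|split; [|split]].
  - apply C_Kn_intro with (a * exp (- kap)) (b * exp kap); auto.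
    intros t x hx. unfold omega.
    rewrite (gE_zero T g0 h0 a b kap); auto; [ring|lra].
  - apply C_Kn_intro with (a * exp (- kap)) (b * exp kap); auto.
    intros t x hx. apply zr. apply (Yof_outside a b kap); auto. lra.
  - intros t x ht hx u.
    assert (hu : u = x * vE beta1 beta2 T g0 h0 Z t x).
    { apply (velocity_gE beta1 beta2 T g0 h0 a b kap); auto. lra. }
    assert (d1 := sourced_equation beta1 beta2 T g0 h0 a b kap G L hT ha (proj1 hb) hkap hbk
      g0c h0c g0b h0b g0l g0z h0z hTc Z hZ hfix t x _ ht
      (Derive_correct _ _ (class_C_ex_derive n _ x hn (CC_class_C n omega t hom)))).
    assert (d2 := transported_equation beta1 beta2 T g0 h0 a b kap G L hT ha (proj1 hb) hkap hbk
      g0c h0c g0b h0b g0l g0z h0z hTc Z hZ hfix rho0 t x _ ht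
      (Derive_correct _ _ (class_C_ex_derive n _ x hn (CC_class_C n rho t hrh)))).
    rewrite <- hu in d1, d2.
    split; [eexists; exact d1|]. split; [|split; [eexists; exact d2|]].
    + replace (Derive (fun s => omega s x) t) with
        (- u * Derive (omega t) x + x * h0 (Yof Z (t, 0) x) *
           (exp (- Z (t, 0) x) * exp (- Z (t, 0) x)))
        by (symmetry; apply is_derive_unique; exact d1).
      (* The source is rho/x: the two factors [exp (- Z)] cancel the two divisions by
         [Y = x * exp (- Z)] up to [x ^ 2]. *)
      unfold rho, h0, Yof. assert (q := exp_pos (- Z (t, 0) x)).
      field. lra.
    + replace (Derive (fun s => rho s x) t) with (- u * Derive (rho t) x)
        by (symmetry; apply is_derive_unique; exact d2).
      ring.
  - intros x. unfold omega, rho, gE.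
    assert (hY : Yof Z (0, 0) x = x).
    { apply (Yof_diag beta1 beta2 T g0 h0); auto. }
    assert (hZ0 : Z (0, 0) x = 0).
    { apply (flow_diag beta1 beta2 T g0 h0); auto. }
    rewrite hY, hZ0, (clamp_id T 0), RInt_point, Ropp_0, exp_0 by lra.
    split; auto. change zero with 0. unfold g0.
    (* At [x = 0] the product [x * g0 x] does not cancel, but [omega0 0 = 0] because 0 lies left of
       [a]. *)
    destruct (Req_dec x 0) as [->|hx].
    + rewrite zw by lra. ring.
    + field. auto.
Qed.

Theorem theorem1 (beta1 beta2 : R) (n : nat)
  (hbeta2_pos : 0 < beta2) (hbeta2_le : beta2 <= 1) (hbeta1 : 1 <= beta1)
  (hn : (1 <= n)%nat)
  (omega0 rho0 : R -> R)
  (homega0 : Kn n omega0) (hrho0 : Kn n rho0)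
  (homega0_nonneg : forall x, 0 <= omega0 x)
  (hrho0_nonneg : forall x, 0 <= rho0 x) :
  exists T : R, 0 < T /\
    exists omega rho : R -> R -> R,
      is_solution n beta1 beta2 T omega0 rho0 omega rho /\
      forall omega' rho' : R -> R -> R,
        is_solution n beta1 beta2 T omega0 rho0 omega' rho' ->
        forall t x, 0 <= t <= T ->
          omega' t x = omega t x /\ rho' t x = rho t x.
Proof.
  destruct (solution_exists beta1 beta2 n omega0 rho0 (conj hbeta2_pos hbeta2_le)
    hbeta1 hn homega0 hrho0) as [T [hT [omega [rho hsol]]]].
  exists T. split; auto. exists omega, rho. split; auto.
  intros omega' rho' hsol' t x ht.
  apply (solution_unique n beta1 beta2 T omega0 rho0 omega' rho' omega rho); auto.
Qed.
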